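(* Let $R$ be a commutative noetherian ring, let $C$ be a semidualizing $R$-module, let $M$ be a finitely generated $R$-module, let $N$ be an $R$-module, and let $I$ be an injective $R$-module. Then for all $i\geq 0$ there are isomorphisms $$\operatorname{Tor}^{\mathcal{P}_C\mathcal{M}}_i(M,\operatorname{Hom}_R(N,I))\cong\operatorname{Hom}_R(\operatorname{Ext}^i_{\mathcal{P}_C\mathcal{M}}(M,N),I),$$ $$\operatorname{Tor}^{\mathcal{M}\mathcal{P}_C}_i(M,\operatorname{Hom}_R(N,I))\cong\operatorname{Hom}_R(\operatorname{Ext}^i_{\mathcal{M}\mathcal{I}_C}(M,N),I).$$
   Context: $R$ is a commutative noetherian ring. A finitely generated $R$-module $C$ is semidualizing if the homothety map $R\to\operatorname{Hom}_R(C,C)$ is an isomorphism and $\operatorname{Ext}^i_R(C,C)=0$ for all $i\geq 1$. $\mathcal{P}_C(R)$ is the class of $R$-modules isomorphic to $P\otimes_R C$ with $P$ projective, and $\mathcal{I}_C(R)$ is the class of $R$-modules isomorphic to $\operatorname{Hom}_R(C,E)$ with $E$ injective; the first is precovering and the second is preenveloping. A proper $\mathcal{P}_C$-resolution of $M$ is a complex $L=(\cdots\to L_1\to L_0\to 0)$ of modules in $\mathcal{P}_C(R)$ with an augmentation $L_0\to M$ such that $L^+=(\cdots\to L_1\to L_0\to M\to 0)$ is a complex (not necessarily exact) and $\operatorname{Hom}_R(Y,L^+)$ is exact for all $Y\in\mathcal{P}_C(R)$. Dually, a proper $\mathcal{I}_C$-coresolution of $N$ is a complex $J=(0\to J^0\to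 J^1\to\cdots)$ of modules in $\mathcal{I}_C(R)$ with an augmentation $N\to J^0$ such that $J^+=(0\to N\to J^0\to J^1\to\cdots)$ is a complex and $\operatorname{Hom}_R(J^+,Y)$ is exact for all $Y\in\mathcal{I}_C(R)$. With $L$ a proper $\mathcal{P}_C$-resolution of $M$, $L'$ a proper $\mathcal{P}_C$-resolution of $N$, and $J$ a proper $\mathcal{I}_C$-coresolution of $N$, set for each $i\ge 0$: $\operatorname{Tor}^{\mathcal{P}_C\mathcal{M}}_i(M,N):=H_i(L\otimes_R N)$, $\operatorname{Tor}^{\mathcal{M}\mathcal{P}_C}_i(M,N):=H_i(M\otimes_R L')$, $\operatorname{Ext}^i_{\mathcal{P}_C\mathcal{M}}(M,N):=H_{-i}(\operatorname{Hom}_R(L,N))$, $\operatorname{Ext}^i_{\mathcal{M}\mathcal{I}_C}(M,N):=H_{-i}(\operatorname{Hom}_R(M,J))$ (the $i$-th cohomology). These are independent of choices. *)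

(* Defs.v *)
From HB Require Import structures.
From mathcomp Require Import all_boot all_algebra finmap.
From mathcomp Require Import boolp classical_sets functions cardinality fsbigop.

Set Implicit Arguments.
Unset Strict Implicit.
Unset Printing Implicit Defensive.

Import GRing.Theory.
Local Open Scope classical_set_scope.
Local Open Scope quotient_scope.
Local Open Scope ring_scope.

(* Rings are [comPzRingType]s, so that the zero ring is allowed.  The module
   Hom_R(U, V) is the type {linear U -> V}, with the pointwise structure. *)

Section HomModule.
Variables (R : comPzRingType) (U V : lmodType R).
Implicit Types f g h : {linear U -> V}.

HB.instance Definition _ := gen_eqMixin {linear U -> V}.
HB.instance Definition _ := gen_choiceMixin {linear U -> V}.

Lemma linear_ext f g : f =1 g -> f = g.
Proof.
case: f g => f [[fD] [fZ]] [g [[gD] [gZ]]] /= /funext fg; subst g.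
congr GRing.Linear.Pack; congr GRing.Linear.Class; congr (_ _);
  exact: Prop_irrelevance.
Qed.

Definition lin_zero : {linear U -> V} := \0.
Definition lin_opp f : {linear U -> V} := \- f.
Definition lin_add f g : {linear U -> V} := f \+ g.
Definition lin_scale (a : R) f : {linear U -> V} := a \*: f.

Lemma lin_addA : associative lin_add.
Proof. by move=> f g h; apply: linear_ext => x /=; rewrite addrA. Qed.
Lemma lin_addC : commutative lin_add.
Proof. by move=> f g; apply: linear_ext => x /=; rewrite addrC. Qed.
Lemma lin_add0 : left_id lin_zero lin_add.
Proof. by move=> f; apply: linear_ext => x /=; rewrite add0r. Qed.
Lemma lin_addN : left_inverse lin_zero lin_opp lin_add.
Proof. by move=> f; apply: linear_ext => x /=; rewrite addNr. Qed.

HB.instance Definition _ :=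
  GRing.isZmodule.Build {linear U -> V} lin_addA lin_addC lin_add0 lin_addN.

Lemma lin_scaleA a b f : lin_scale a (lin_scale b f) = lin_scale (a * b) f.
Proof. by apply: linear_ext => x /=; rewrite scalerA. Qed.
Lemma lin_scale1 : left_id 1 lin_scale.
Proof. by move=> f; apply: linear_ext => x /=; rewrite scale1r. Qed.
Lemma lin_scaleDr : right_distributive lin_scale +%R.
Proof. by move=> a f g; apply: linear_ext => x /=; rewrite scalerDr. Qed.
Lemma lin_scaleDl f : {morph lin_scale^~ f : a b / a + b}.
Proof. by move=> a b; apply: linear_ext => x /=; rewrite scalerDl. Qed.

HB.instance Definition _ := GRing.Zmodule_isLmodule.Build R {linear U -> V}
  lin_scaleA lin_scale1 lin_scaleDr lin_scaleDl.

End HomModule.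

Section HomFunctor.
Variables (R : comPzRingType) (U V W : lmodType R).

Definition hom_post_fun (f : {linear U -> V}) (h : {linear W -> U}) :
  {linear W -> V} := f \o h.

Lemma hom_post_linear f : linear (hom_post_fun f).
Proof. by move=> a h k; apply: linear_ext => x /=; rewrite linearP. Qed.

HB.instance Definition _ f := GRing.isLinear.Build R
  {linear W -> U} {linear W -> V} *:%R (hom_post_fun f) (hom_post_linear f).

(* Hom(W, f) *)
Definition hom_post f : {linear {linear W -> U} -> {linear W -> V}} :=
  hom_post_fun f.

Definition hom_pre_fun (f : {linear U -> V}) (h : {linear V -> W}) :
  {linear U -> W} := h \o f.

Lemma hom_pre_linear f : linear (hom_pre_fun f).
Proof. by move=> a h k; apply: linear_ext => x. Qed.

HB.instance Definition _ f := GRing.isLinear.Build R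
  {linear V -> W} {linear U -> W} *:%R (hom_pre_fun f) (hom_pre_linear f).

(* Hom(f, W) *)
Definition hom_pre f : {linear {linear V -> W} -> {linear U -> W}} :=
  hom_pre_fun f.

End HomFunctor.

(* The quotient V / S; the abelian group structure is that of ring_quotient. *)
Section QuotientModule.
Variables (R : comPzRingType) (V : lmodType R) (S : submodClosed V).

Lemma submod_oppr_closed : oppr_closed S.
Proof. by move=> x Sx; rewrite -scaleN1r rpredZ. Qed.

Definition submod_zmod : zmodClosed V :=
  HB.pack (GRing.SubmodClosed.sort S)
    (GRing.isOppClosed.Build V (GRing.SubmodClosed.sort S) submod_oppr_closed).

Definition quotmod := Quotient.quot submod_zmod.
HB.instance Definition _ := GRing.Zmodule.on quotmod.

Definition quot_pi (x : V) : quotmod := \pi_(Quotient.quot submod_zmod) x.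
Definition quot_scale (a : R) (z : quotmod) : quotmod :=
  quot_pi (a *: repr (z : Quotient.quot submod_zmod)).

Lemma quot_piP x y : reflect (quot_pi x = quot_pi y) (x - y \in S).
Proof. by rewrite (@Quotient.idealrBE _ submod_zmod); exact: eqP. Qed.

Lemma quot_pi_surj (z : quotmod) : exists x, quot_pi x = z.
Proof. by exists (repr (z : Quotient.quot submod_zmod)); exact: reprK. Qed.

Lemma quot_piD x y : quot_pi (x + y) = quot_pi x + quot_pi y.
Proof. exact: (raddfD \pi_(Quotient.quot submod_zmod)). Qed.

Lemma quot_scaleE a x : quot_scale a (quot_pi x) = quot_pi (a *: x).
Proof.
apply/quot_piP; rewrite -scalerBr rpredZ //; apply/quot_piP.
exact: reprK.
Qed.

Lemma quot_scaleA a b z : quot_scale a (quot_scale b z) = quot_scale (a * b) z.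
Proof. by have [x <-] := quot_pi_surj z; rewrite !quot_scaleE scalerA. Qed.
Lemma quot_scale1 : left_id 1 quot_scale.
Proof. by move=> z; have [x <-] := quot_pi_surj z; rewrite quot_scaleE scale1r. Qed.
Lemma quot_scaleDr : right_distributive quot_scale +%R.
Proof.
move=> a z w; have [x <-] := quot_pi_surj z; have [y <-] := quot_pi_surj w.
by rewrite -quot_piD !quot_scaleE scalerDr quot_piD.
Qed.
Lemma quot_scaleDl z : {morph quot_scale^~ z : a b / a + b}.
Proof.
move=> a b; have [x <-] := quot_pi_surj z.
by rewrite !quot_scaleE scalerDl quot_piD.
Qed.

HB.instance Definition _ := GRing.Zmodule_isLmodule.Build R quotmod
  quot_scaleA quot_scale1 quot_scaleDr quot_scaleDl.

Lemma quot_pi_is_linear : linear quot_pi.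
Proof. by move=> a x y; rewrite quot_piD -quot_scaleE. Qed.
HB.instance Definition _ :=
  GRing.isLinear.Build R V quotmod *:%R quot_pi quot_pi_is_linear.

Section Lift.
Variables (W : lmodType R) (f : {linear V -> W}).
Hypothesis f0 : forall x, x \in S -> f x = 0.

(* The map V / S -> W induced by a linear map vanishing on S. *)
Definition quot_lift_fun of (forall x, x \in S -> f x = 0) := fun z : quotmod =>
  f (repr (z : Quotient.quot submod_zmod)).

Lemma quot_lift_funE x : quot_lift_fun f0 (quot_pi x) = f x.
Proof.
apply/eqP; rewrite -subr_eq0 -linearB; apply/eqP/f0/quot_piP; exact: reprK.
Qed.

Lemma quot_lift_linear : linear (quot_lift_fun f0).
Proof.
move=> a z w; have [x <-] := quot_pi_surj z; have [y <-] := quot_pi_surj w.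
by rewrite -linearP !quot_lift_funE linearP.
Qed.
HB.instance Definition _ := GRing.isLinear.Build R quotmod W *:%R
  (quot_lift_fun f0) quot_lift_linear.

Definition quot_lift : {linear quotmod -> W} := quot_lift_fun f0.

Lemma quot_liftE x : quot_lift (quot_pi x) = f x.
Proof. exact: quot_lift_funE. Qed.

End Lift.
End QuotientModule.

(* The submodule spanned by a set of vectors. *)
Section Span.
Variables (R : comPzRingType) (V : lmodType R) (X : set V).

Definition span : {pred V} := fun x =>
  `[< forall S : submodClosed V, (forall y, X y -> y \in S) -> x \in S >].

Lemma span_submod : submod_closed span.
Proof.
split=> [|a x y /asboolP Sx /asboolP Sy]; apply/asboolP => S XS.
  exact: rpred0.
by rewrite rpredD // ?rpredZ // ?Sx ?Sy.
Qed.
HB.instance Definition _ := GRing.isSubmodClosed.Build R V span span_submod.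

End Span.

(* The free module on a set, as the finitely supported functions. *)
Section FreeModule.
Variables (R : comPzRingType) (X : choiceType).

Definition fin_supp : {pred X -> R^o} := fun f =>
  `[< finite_set [set x | f x != 0] >].

Lemma finsupp_submod : submod_closed fin_supp.
Proof.
split=> [|a f g /asboolP fin_f /asboolP fin_g]; apply/asboolP.
  rewrite (_ : [set _ | _] = set0) //.
  by apply/seteqP; split=> x //=; rewrite eqxx.
apply: (@sub_finite_set _ _ ([set x | f x != 0] `|` [set x | g x != 0])).
  move=> x /= fgx; have [f0|] := eqVneq (f x) 0; last by left.
  by right; move: fgx; rewrite !fctE f0 scaler0 add0r.
by rewrite finite_setU.
Qed.
HB.instance Definition _ := GRing.isSubmodClosed.Build R (X -> R^o) fin_supp
  finsupp_submod.

Record freemod := FreeMod { freemod_val :> X -> R^o; _ : freemod_val \in fin_supp }.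
HB.instance Definition _ := [isSub for freemod_val].
HB.instance Definition _ := [Choice of freemod by <:].
HB.instance Definition _ := [SubChoice_isSubLmodule of freemod by <:].

Lemma freemod_gen_subproof (x : X) : (fun y => (y == x)%:R : R^o) \in fin_supp.
Proof.
apply/asboolP; apply: (sub_finite_set _ (finite_set1 x)) => y /=.
by have [->|] := eqVneq y x; rewrite ?eqxx.
Qed.
Definition freemod_gen x := FreeMod (freemod_gen_subproof x).

Variables (W : lmodType R) (g : X -> W).

Definition freemod_lift_fun (f : freemod) : W := \sum_(x \in setT) f x *: g x.

Lemma freemod_lift_funE (f : freemod) (A : {fset X}) :
  (forall x, x \notin A -> f x = 0) ->
  freemod_lift_fun f = \sum_(x <- A) f x *: g x.
Proof. by move=> f0; apply: fsbigTE => x /f0 ->; rewrite scale0r. Qed.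

Lemma freemod_lift_linear : linear freemod_lift_fun.
Proof.
move=> a f h; have /asboolP/finite_fsetP[A fA] := valP f.
have /asboolP/finite_fsetP[B hB] := valP h.
have f0 x : x \notin (A `|` B)%fset -> f x = 0.
  rewrite inE negb_or => /andP[xA _]; apply/eqP; apply: contraNT xA => fx.
  by move: (fx : [set x | (f : X -> R) x != 0] x); rewrite fA.
have h0 x : x \notin (A `|` B)%fset -> h x = 0.
  rewrite inE negb_or => /andP[_ xB]; apply/eqP; apply: contraNT xB => hx.
  by move: (hx : [set x | (h : X -> R) x != 0] x); rewrite hB.
have fhE x : freemod_val (a *: f + h) x = a * f x + h x by [].
have fh0 x : x \notin (A `|` B)%fset -> freemod_val (a *: f + h) x = 0.
  by move=> xAB; apply: etrans (fhE x) _; rewrite f0 ?h0 // mulr0 addr0.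
rewrite (freemod_lift_funE fh0) (freemod_lift_funE f0) (freemod_lift_funE h0).
rewrite scaler_sumr -big_split /=; apply: eq_bigr => x _.
by rewrite [X in X *: _](fhE x) scalerDl scalerA.
Qed.
HB.instance Definition _ := GRing.isLinear.Build R freemod W *:%R
  freemod_lift_fun freemod_lift_linear.

Definition freemod_lift : {linear freemod -> W} := freemod_lift_fun.

Lemma freemod_liftE x : freemod_lift (freemod_gen x) = g x.
Proof.
rewrite /= (@freemod_lift_funE _ [fset x]%fset) => [|y]; last first.
  by rewrite inE /= => /negbTE ->.
by rewrite big_seq_fset1 /= eqxx scale1r.
Qed.

End FreeModule.

Section FreeModuleExt.
Variables (R : comPzRingType) (X : choiceType).

Lemma freemod_eta (f : freemod R X) : freemod_lift (@freemod_gen R X) f = f.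
Proof.
have /asboolP/finite_fsetP[A fA] := valP f.
have f0 x : x \notin A -> f x = 0.
  move=> xA; apply/eqP; apply: contraNT xA => fx.
  by move: (fx : [set x | (f : X -> R) x != 0] x); rewrite fA.
rewrite /= (freemod_lift_funE _ f0); apply/val_inj/funext => y.
have evalE (s : seq X) :
    freemod_val (\sum_(x <- s) (f x : R) *: freemod_gen R x) y
    = \sum_(x <- s) (f x : R) * (y == x)%:R.
  elim: s => [|x s IHs]; first by rewrite !big_nil.
  by rewrite !big_cons -IHs.
rewrite [LHS]evalE; have [yA|yA] := boolP (y \in A).
  rewrite (big_fsetD1 y) //= eqxx mulr1 big1_seq ?addr0 // => x.
  by rewrite !inE => /and3P[_ xy _]; rewrite eq_sym (negbTE xy) mulr0.
rewrite big1_seq => [|x /andP[_ xA]]; first by rewrite [RHS]f0.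
by have [yx|] := eqVneq y x; [rewrite yx xA in yA | rewrite mulr0].
Qed.

Lemma freemod_ext (W : lmodType R) (f g : {linear freemod R X -> W}) :
  (forall x, f (freemod_gen R x) = g (freemod_gen R x)) -> f = g.
Proof.
move=> fg; apply: linear_ext => h; rewrite -(freemod_eta h) /=.
rewrite /freemod_lift_fun !linear_sum; apply: eq_bigr => x _.
by rewrite !linearZ fg.
Qed.

End FreeModuleExt.

Section Tensor.
Variables (R : comPzRingType) (U V : lmodType R).

Let e (u : U) (v : V) : freemod R (U * V)%type := freemod_gen R (u, v).

Definition tensor_rel : set (freemod R (U * V)%type) := [set z |
  [\/ exists u u' v, z = e (u + u') v - e u v - e u' v,
      exists u v v', z = e u (v + v') - e u v - e u v',
      exists a u v, z = e (a *: u) v - a *: e u v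
    | exists a u v, z = e u (a *: v) - a *: e u v ] ].

Definition tensor : lmodType R := quotmod (span tensor_rel).

Definition tens (u : U) (v : V) : tensor := quot_pi _ (e u v).

Lemma tensor_rel0 z : tensor_rel z -> quot_pi (span tensor_rel) z = 0.
Proof.
move=> zr; rewrite -(linear0 (quot_pi (span tensor_rel))); apply/quot_piP.
by rewrite subr0; apply/asboolP => S; apply.
Qed.

Lemma tensDl u u' v : tens (u + u') v = tens u v + tens u' v.
Proof.
apply/eqP; rewrite -subr_eq0 opprD addrA -!linearB; apply/eqP/tensor_rel0.
by constructor 1; exists u, u', v.
Qed.
Lemma tensDr u v v' : tens u (v + v') = tens u v + tens u v'.
Proof.
apply/eqP; rewrite -subr_eq0 opprD addrA -!linearB; apply/eqP/tensor_rel0.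
by constructor 2; exists u, v, v'.
Qed.
Lemma tensZl a u v : tens (a *: u) v = a *: tens u v.
Proof.
apply/eqP; rewrite -subr_eq0 -linearZ -linearB; apply/eqP/tensor_rel0.
by constructor 3; exists a, u, v.
Qed.
Lemma tensZr a u v : tens u (a *: v) = a *: tens u v.
Proof.
apply/eqP; rewrite -subr_eq0 -linearZ -linearB; apply/eqP/tensor_rel0.
by constructor 4; exists a, u, v.
Qed.

Lemma tens0l v : tens 0 v = 0.
Proof. by rewrite -(scale0r (0 : U)) tensZl scale0r. Qed.
Lemma tens0r u : tens u 0 = 0.
Proof. by rewrite -(scale0r (0 : V)) tensZr scale0r. Qed.

Section Lift.
Variables (W : lmodType R) (b : {linear U -> {linear V -> W}}).

Let b_free := freemod_lift (fun p : U * V => b p.1 p.2).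

Lemma tensor_lift_subproof z : z \in span tensor_rel -> b_free z = 0.
Proof.
pose K : {pred freemod R (U * V)%type} := fun z => b_free z == 0.
have K_closed : submod_closed K.
  split=> [|a x y]; rewrite !unfold_in ?linear0 // linearP.
  by move=> /eqP -> /eqP ->; rewrite scaler0 addr0.
pose Km := GRing.isSubmodClosed.Build R _ K K_closed.
pose KS : submodClosed (freemod R (U * V)%type) := HB.pack K Km.
move=> /asboolP /(_ KS) zK; apply/eqP; apply: zK => y.
have E u v : b_free (e u v) = b u v by exact: freemod_liftE.
case=> [[u [u' [v ->]]]|[u [v [v' ->]]]|[a [u [v ->]]]|[a [u [v ->]]]].
- by rewrite unfold_in /= !linearB /= !E linearD /= -addrA -opprD subrr.
- by rewrite unfold_in /= !linearB /= !E linearD /= -addrA -opprD subrr.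
- by rewrite unfold_in /= linearB linearZ /= !E linearZ /= subrr.
- by rewrite unfold_in /= linearB linearZ /= !E linearZ /= subrr.
Qed.

Definition tensor_lift : {linear tensor -> W} :=
  quot_lift tensor_lift_subproof.

Lemma tensor_liftE u v : tensor_lift (tens u v) = b u v.
Proof. by rewrite /tensor_lift quot_liftE freemod_liftE. Qed.

End Lift.

Lemma tensor_ext (W : lmodType R) (f g : {linear tensor -> W}) :
  (forall u v, f (tens u v) = g (tens u v)) -> f = g.
Proof.
move=> fg; apply: linear_ext => z; have [x <-] := quot_pi_surj z.
have: f \o quot_pi (span tensor_rel) = g \o quot_pi (span tensor_rel)
  :> {linear _ -> _} by apply: freemod_ext => -[u v]; exact: fg.
by move=> /(congr1 (fun h : {linear _ -> _} => h x)).
Qed.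

End Tensor.

Section TensorFunctor.
Variables (R : comPzRingType) (U U' V V' : lmodType R).
Variables (f : {linear U -> U'}) (g : {linear V -> V'}).

Definition tensor_map_bil_fun2 u v : tensor U' V' := tens (f u) (g v).

Lemma tensor_map_bil_linear2 u : linear (tensor_map_bil_fun2 u).
Proof.
by move=> a v w; rewrite /tensor_map_bil_fun2 linearP tensDr tensZr.
Qed.
HB.instance Definition _ u := GRing.isLinear.Build R V (tensor U' V') *:%R
  (tensor_map_bil_fun2 u) (tensor_map_bil_linear2 u).

Definition tensor_map_bil_fun u : {linear V -> tensor U' V'} :=
  tensor_map_bil_fun2 u.

Lemma tensor_map_bil_linear : linear tensor_map_bil_fun.
Proof.
move=> a u w; apply: linear_ext => v.
by rewrite /= /tensor_map_bil_fun2 linearP tensDl tensZl.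
Qed.
HB.instance Definition _ := GRing.isLinear.Build R U
  {linear V -> tensor U' V'} *:%R tensor_map_bil_fun tensor_map_bil_linear.

(* f (x) g *)
Definition tensor_map : {linear tensor U V -> tensor U' V'} :=
  tensor_lift tensor_map_bil_fun.

Lemma tensor_mapE u v : tensor_map (tens u v) = tens (f u) (g v).
Proof. exact: tensor_liftE. Qed.

End TensorFunctor.

Lemma tensor_map_comp0 (R : comPzRingType) (U U' U'' V V' V'' : lmodType R)
    (f : {linear U -> U'}) (f' : {linear U' -> U''})
    (g : {linear V -> V'}) (g' : {linear V' -> V''}) :
  (forall u v, tens (f' (f u)) (g' (g v)) = 0) ->
  forall z, tensor_map f' g' (tensor_map f g z) = 0.
Proof.
move=> fg0 z; pose h : {linear _ -> _} := tensor_map f' g' \o tensor_map f g.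
have h0 : h = \0 :> {linear _ -> _}.
  apply: tensor_ext => u v.
  rewrite -[LHS]/(tensor_map f' g' (tensor_map f g (tens u v))).
  by rewrite !tensor_mapE fg0.
by rewrite -[LHS]/(h z) h0.
Qed.

Section Modules.
Variable R : comPzRingType.
Implicit Types U V M P E : lmodType R.

Definition mod_iso U V : Prop := exists f : {linear U -> V}, bijective f.

Definition generates V (s : seq V) (S : {pred V}) : Prop :=
  {subset s <= S} /\ forall x, x \in S ->
    exists a : 'I_(size s) -> R, x = \sum_(i < size s) a i *: s`_i.

Definition fin_gen V : Prop := exists s : seq V, generates s predT.

(* The ideals of R are the submodules of R^o. *)
Definition noetherian : Prop :=
  forall J : submodClosed R^o, exists s : seq R^o, generates s J.

Definition projective P : Prop :=
  forall U V (g : {linear U -> V}) (h : {linear P -> V}),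
    (forall y, exists x, g x = y) ->
    exists k : {linear P -> U}, forall x, g (k x) = h x.

Definition injective_mod E : Prop :=
  forall U V (g : {linear U -> V}) (h : {linear U -> E}),
    injective g -> exists k : {linear V -> E}, forall x, k (g x) = h x.

End Modules.

Arguments noetherian : clear implicits.

(* ker g / im f for U --f--> V --g--> W.  The submodule divided out is
   im f :&: ker g, which is im f whenever g \o f = 0. *)
Section Homology.
Variables (R : comPzRingType) (U V W : lmodType R).
Variables (f : {linear U -> V}) (g : {linear V -> W}).

Definition in_kernel : {pred V} := fun x => g x == 0.

Lemma in_kernel_submod : submod_closed in_kernel.
Proof.
split=> [|a x y]; rewrite !unfold_in ?linear0 // linearP.
by move=> /eqP -> /eqP ->; rewrite scaler0 addr0.
Qed.
HB.instance Definition _ := GRing.isSubmodClosed.Build R V in_kernel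
  in_kernel_submod.

Record kernel := Kernel { kernel_val :> V; _ : kernel_val \in in_kernel }.
HB.instance Definition _ := [isSub for kernel_val].
HB.instance Definition _ := [Choice of kernel by <:].
HB.instance Definition _ := [SubChoice_isSubLmodule of kernel by <:].

Definition boundary : {pred kernel} := fun z =>
  `[< exists x, f x = kernel_val z >].

Lemma boundary_submod : submod_closed boundary.
Proof.
split=> [|a z w /asboolP[x xz] /asboolP[y yw]]; apply/asboolP.
  by exists 0; rewrite linear0.
by exists (a *: x + y); rewrite linearP xz yw.
Qed.
HB.instance Definition _ := GRing.isSubmodClosed.Build R kernel boundary
  boundary_submod.

Definition homology_at : lmodType R := quotmod boundary.

End Homology.

(* ... -> X 1 -> X 0 -> 0 *)
Record chain (R : comPzRingType) := Chain {
  chain_obj :> nat -> lmodType R;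
  chain_d : forall n, {linear chain_obj n.+1 -> chain_obj n};
  chain_dd : forall n x, chain_d n (chain_d n.+1 x) = 0
}.

(* 0 -> X 0 -> X 1 -> ... *)
Record cochain (R : comPzRingType) := Cochain {
  cochain_obj :> nat -> lmodType R;
  cochain_d : forall n, {linear cochain_obj n -> cochain_obj n.+1};
  cochain_dd : forall n x, cochain_d n.+1 (cochain_d n x) = 0
}.

Section Complexes.
Variable R : comPzRingType.
Implicit Types (X : chain R) (Z : cochain R) (U V M : lmodType R).

(* In degree 0 the map leaving X 0 is taken to be the zero endomorphism. *)
Definition chain_out X n : {linear X n -> X n.-1} :=
  match n with 0 => \0 | m.+1 => chain_d X m end.

Definition chain_homology X n : lmodType R :=
  homology_at (chain_d X n) (chain_out X n).

Definition chain_exact X : Prop := forall n (z : chain_homology X n), z = 0.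

Definition cochain_in Z n : {linear Z n.-1 -> Z n} :=
  match n with 0 => \0 | m.+1 => cochain_d Z m end.

(* H^n(Z) = H_{-n}(Z) *)
Definition cochain_cohomology Z n : lmodType R :=
  homology_at (cochain_in Z n) (cochain_d Z n).

Lemma hom_chain_dd V X n (h : {linear V -> X n.+2}) :
  hom_post V (chain_d X n) (hom_post V (chain_d X n.+1) h) = 0.
Proof. by apply: linear_ext => x /=; rewrite chain_dd. Qed.

(* Hom(V, X) *)
Definition hom_chain V X : chain R :=
  Chain (fun n => hom_chain_dd (V := V) (X := X) (n := n)).

Lemma chain_hom_dd X V n (h : {linear X n -> V}) :
  hom_pre V (chain_d X n.+1) (hom_pre V (chain_d X n) h) = 0.
Proof. by apply: linear_ext => x /=; rewrite chain_dd linear0. Qed.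

(* Hom(X, V) *)
Definition chain_hom X V : cochain R :=
  Cochain (fun n => chain_hom_dd (X := X) (V := V) (n := n)).

Lemma hom_cochain_dd V Z n (h : {linear V -> Z n}) :
  hom_post V (cochain_d Z n.+1) (hom_post V (cochain_d Z n) h) = 0.
Proof. by apply: linear_ext => x /=; rewrite cochain_dd. Qed.

(* Hom(V, Z) *)
Definition hom_cochain V Z : cochain R :=
  Cochain (fun n => hom_cochain_dd (V := V) (Z := Z) (n := n)).

Lemma cochain_hom_dd Z V n (h : {linear Z n.+2 -> V}) :
  hom_pre V (cochain_d Z n) (hom_pre V (cochain_d Z n.+1) h) = 0.
Proof. by apply: linear_ext => x /=; rewrite cochain_dd linear0. Qed.

(* Hom(Z, V) *)
Definition cochain_hom Z V : chain R :=
  Chain (fun n => cochain_hom_dd (Z := Z) (V := V) (n := n)).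

Lemma chain_tensor_dd X V n (z : tensor (X n.+2) V) :
  tensor_map (chain_d X n) (@idfun V) (tensor_map (chain_d X n.+1) (@idfun V) z)
    = 0.
Proof. by apply: tensor_map_comp0 => u v; rewrite chain_dd tens0l. Qed.

(* X (x) V *)
Definition chain_tensor X V : chain R :=
  Chain (fun n => chain_tensor_dd (X := X) (V := V) (n := n)).

Lemma tensor_chain_dd V X n (z : tensor V (X n.+2)) :
  tensor_map (@idfun V) (chain_d X n) (tensor_map (@idfun V) (chain_d X n.+1) z)
    = 0.
Proof. by apply: tensor_map_comp0 => v u; rewrite chain_dd tens0r. Qed.

(* V (x) X *)
Definition tensor_chain V X : chain R :=
  Chain (fun n => tensor_chain_dd (V := V) (X := X) (n := n)).

End Complexes.

Record augmented (R : comPzRingType) (M : lmodType R) := Augmented {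
  aug_chain :> chain R;
  aug : {linear aug_chain 0 -> M};
  aug_d : forall x, aug (chain_d aug_chain 0 x) = 0
}.

Record coaugmented (R : comPzRingType) (M : lmodType R) := Coaugmented {
  coaug_cochain :> cochain R;
  coaug : {linear M -> coaug_cochain 0};
  coaug_d : forall x, cochain_d coaug_cochain 0 (coaug x) = 0
}.

Section Augmentation.
Variables (R : comPzRingType) (M : lmodType R).
Implicit Types (L : augmented M) (J : coaugmented M).

Definition plus_obj L n : lmodType R := if n is m.+1 then L m else M.

Definition plus_d L n : {linear plus_obj L n.+1 -> plus_obj L n} :=
  match n with 0 => aug L | m.+1 => chain_d L m end.

Lemma plus_dd L n x : plus_d L n (plus_d L n.+1 x) = 0.
Proof. by case: n x => [|n] x; [exact: aug_d | exact: chain_dd]. Qed.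

(* L^+ = (... -> L 1 -> L 0 -> M -> 0), with M placed in degree 0. *)
Definition plus_chain L : chain R := Chain (@plus_dd L).

Definition coplus_obj J n : lmodType R := if n is m.+1 then J m else M.

Definition coplus_d J n : {linear coplus_obj J n -> coplus_obj J n.+1} :=
  match n with 0 => coaug J | m.+1 => cochain_d J m end.

Lemma coplus_dd J n x : coplus_d J n.+1 (coplus_d J n x) = 0.
Proof. by case: n x => [|n] x; [exact: coaug_d | exact: cochain_dd]. Qed.

(* J^+ = (0 -> M -> J 0 -> J 1 -> ...), with M placed in degree 0. *)
Definition coplus_cochain J : cochain R := Cochain (@coplus_dd J).

End Augmentation.

Record proj_resolution (R : comPzRingType) (M : lmodType R) := ProjResolution {
  proj_res :> augmented M;
  proj_res_projective : forall n, projective (proj_res n);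
  proj_res_exact : chain_exact (plus_chain proj_res)
}.

(* Ext^i(M, N), computed from the projective resolution P of M. *)
Definition Ext (R : comPzRingType) (M : lmodType R) (P : proj_resolution M)
  (N : lmodType R) (i : nat) : lmodType R := cochain_cohomology (chain_hom P N) i.

Section Semidualizing.
Variables (R : comPzRingType) (C : lmodType R).

Definition homothety (r : R) : {linear C -> C} := r \*: idfun.

(* Ext does not depend on the resolution, so its vanishing is stated for all
   of them. *)
Definition semidualizing : Prop :=
  [/\ fin_gen C, bijective homothety &
      forall (P : proj_resolution C) i, (1 <= i)%N -> forall z : Ext P C i, z = 0].

Definition in_PC (X : lmodType R) : Prop :=
  exists2 P : lmodType R, projective P & mod_iso X (tensor P C).

Definition in_IC (X : lmodType R) : Prop :=
  exists2 E : lmodType R, injective_mod E & mod_iso X {linear C -> E}.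

Record PC_resolution (M : lmodType R) := PCResolution {
  PC_res :> augmented M;
  PC_res_in : forall n, in_PC (PC_res n);
  PC_res_proper : forall Y, in_PC Y -> chain_exact (hom_chain Y (plus_chain PC_res))
}.

Record IC_coresolution (N : lmodType R) := ICCoresolution {
  IC_res :> coaugmented N;
  IC_res_in : forall n, in_IC (IC_res n);
  IC_res_proper : forall Y, in_IC Y ->
    chain_exact (cochain_hom (coplus_cochain IC_res) Y)
}.

(* The relative derived functors, computed from the (co)resolution given as
   argument, of which they are independent up to isomorphism. *)

Definition Tor_PCM (M : lmodType R) (L : PC_resolution M) (N : lmodType R) i :
  lmodType R := chain_homology (chain_tensor L N) i.

Definition Tor_MPC (M N : lmodType R) (L : PC_resolution N) i :
  lmodType R := chain_homology (tensor_chain M L) i.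

Definition Ext_PCM (M : lmodType R) (L : PC_resolution M) (N : lmodType R) i :
  lmodType R := cochain_cohomology (chain_hom L N) i.

Definition Ext_MIC (M N : lmodType R) (J : IC_coresolution N) i :
  lmodType R := cochain_cohomology (hom_cochain M J) i.

End Semidualizing.

(* Main.v *)
From HB Require Import structures.
Require Import Defs.
From mathcomp Require Import all_boot all_algebra finmap.
From mathcomp Require Import boolp classical_sets functions cardinality.

Set Implicit Arguments.
Unset Strict Implicit.
Unset Printing Implicit Defensive.

Import GRing.Theory.
Local Open Scope quotient_scope.
Local Open Scope ring_scope.

(** Both isomorphisms come from tensor evaluation: for A finitely generated
    over a noetherian ring, hence finitely presented, and I injective, the
    map A (x) Hom(B, I) -> Hom(Hom(A, B), I) is bijective ([teval_bij]).  As
    Hom(-, I) is exact it turns cohomology into homology ([cohomology_dual]),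
    so applying tensor evaluation degree by degree to a suitable complex
    exchanges the relative Tor and the dual of the relative Ext.

    For the first isomorphism the suitable complex is a proper P_C-resolution
    of M by finitely generated modules.  One exists ([power_resolution]):
    finitely many generators of Hom(C, M) give a map C^n -> M through which
    every map C -> M factors, its kernel is again finitely generated, and the
    construction is iterated.  Two proper P_C-resolutions of M are homotopy
    equivalent ([PC_resolution_hequiv]), and homotopy equivalences survive
    both - (x) V and Hom(-, N), so the given resolutions can be replaced by
    this one ([Tor_PCM_dual]).

    For the second, tensor evaluation identifies the dual of Ext(M, N) with
    the homology of M (x) W, where W = Hom(J, I) for J the given proper
    I_C-coresolution of N.  This W is augmented to Hom(N, I), and properness of
    J makes Hom(C, W) a resolution of Hom(C, Hom(N, I)); but W_n, the dual of
    some Hom(C, E), is Hom(E, I) (x) C, where Hom(E, I) is flat and not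
    projective in general.  So W need not be homotopy equivalent to the given
    P_C-resolution L of Hom(N, I), and what has to be shown is that the
    comparison map L -> W becomes a quasi-isomorphism after M (x) -.

    The reason is that for X = T (x) C with T flat, the unit
    T -> Hom(C, T (x) C) is bijective because C is semidualizing
    ([unit_bij]); hence Hom(C, X) is flat and
    M (x) X = (M (x) C) (x) Hom(C, X) ([tcontract_bij]).  The comparison
    therefore takes place between the flat resolutions Hom(C, L) and
    Hom(C, W) of one module, tensored with the finitely generated module
    M (x) C.  The mapping cone of Hom(C, L) -> Hom(C, W) is an exact complex
    of flat modules, and it stays exact under tensor products by dimension
    shifting ([exact_tensor_flat], [quasi_iso_tensor_flat]). *)

(** * Linear maps, isomorphisms and quotients *)

Section LinearMaps.
Variable R : comPzRingType.
Implicit Types U V W : lmodType R.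

Definition mk_lin U V (f : U -> V) (lin_f : linear f) : {linear U -> V} :=
  HB.pack f (GRing.isLinear.Build R U V *:%R f lin_f).

Lemma mk_linE U V (f : U -> V) (lin_f : linear f) x : mk_lin lin_f x = f x.
Proof. by []. Qed.

Definition lin_comp U V W (g : {linear V -> W}) (f : {linear U -> V}) :
  {linear U -> W} := g \o f.

Lemma lin_compE U V W (g : {linear V -> W}) (f : {linear U -> V}) x :
  lin_comp g f x = g (f x).
Proof. by []. Qed.

Lemma lin_addE U V (f g : {linear U -> V}) x : (f + g) x = f x + g x.
Proof. by []. Qed.
Lemma lin_oppE U V (f : {linear U -> V}) x : (- f) x = - f x.
Proof. by []. Qed.
Lemma lin_scaleE U V a (f : {linear U -> V}) x : (a *: f) x = a *: f x.
Proof. by []. Qed.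
Lemma lin_zeroE U V x : (0 : {linear U -> V}) x = 0.
Proof. by []. Qed.
Lemma lin_sumE U V J (r : seq J) (f : J -> {linear U -> V}) x :
  (\sum_(j <- r) f j) x = \sum_(j <- r) f j x.
Proof. by elim/big_rec2: _ => // j y g _ <-. Qed.

Definition lin_id U : {linear U -> U} := @idfun U.

Lemma linear_injP U V (f : {linear U -> V}) :
  injective f <-> forall x, f x = 0 -> x = 0.
Proof.
split=> [f_inj x fx0|f0 x y fxy]; first by apply: f_inj; rewrite fx0 linear0.
by apply/eqP; rewrite -subr_eq0; apply/eqP/f0; rewrite linearB fxy subrr.
Qed.

Lemma bij_of_inj_surj T T' (f : T -> T') :
  injective f -> (forall y, exists x, f x = y) -> bijective f.
Proof.
move=> f_inj /choice[g fg]; exists g => // x.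
by apply: f_inj; rewrite fg.
Qed.

Lemma bij_surj T T' (f : T -> T') : bijective f -> forall y, exists x, f x = y.
Proof. by case=> g _ fK y; exists (g y). Qed.

Lemma linear_bij U V (f : {linear U -> V}) :
  (forall x, f x = 0 -> x = 0) -> (forall y, exists x, f x = y) -> bijective f.
Proof. by move=> /linear_injP; exact: bij_of_inj_surj. Qed.

Definition lin_inv U V (f : {linear U -> V}) (f_bij : bijective f) :
  {g : {linear V -> U} | cancel f g /\ cancel g f}.
Proof.
have [g [fK gK]] : {g : V -> U | cancel f g /\ cancel g f}.
  by apply: cid; case: f_bij => g fK gK; exists g.
have g_lin : linear g.
  by move=> a x y; rewrite -{1}(gK x) -{1}(gK y) -linearP fK.
by exists (mk_lin g_lin).
Qed.

Lemma mod_iso_sym U V : mod_iso U V -> mod_iso V U.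
Proof.
by move=> [f f_bij]; have [g [fK gK]] := lin_inv f_bij; exists g; exists f.
Qed.

Lemma mod_iso_trans V U W : mod_iso U V -> mod_iso V W -> mod_iso U W.
Proof.
by move=> [f f_bij] [g g_bij]; exists (lin_comp g f); exact: bij_comp.
Qed.

Lemma hom_pre_bij U V W (f : {linear U -> V}) :
  bijective f -> bijective (hom_pre W f).
Proof.
move=> f_bij; have [g [fK gK]] := lin_inv f_bij.
by exists (hom_pre W g) => h; apply: linear_ext => x /=; rewrite ?fK ?gK.
Qed.

Lemma mod_iso_hom U V W :
  mod_iso U V -> mod_iso {linear V -> W} {linear U -> W}.
Proof. by move=> [f f_bij]; exists (hom_pre W f); exact: hom_pre_bij. Qed.

Lemma quot_mod_iso V W (S : submodClosed V) (f : {linear V -> W}) :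
  (forall x, x \in S <-> f x = 0) -> (forall y, exists x, f x = y) ->
  mod_iso (quotmod S) W.
Proof.
move=> Sf f_surj; have f0 x : x \in S -> f x = 0 by move/Sf.
exists (quot_lift f0); apply: linear_bij => [z|y].
  have [x <-] := quot_pi_surj z; rewrite quot_liftE => /Sf Sx.
  by rewrite -(linear0 (quot_pi S)); apply/quot_piP; rewrite subr0.
by have [x <-] := f_surj y; exists (quot_pi S x); rewrite quot_liftE.
Qed.

End LinearMaps.

Section FactorThrough.
Variable R : comPzRingType.
Implicit Types U V W : lmodType R.

Lemma quot_pi_eq0 V (S : submodClosed V) x : quot_pi S x = 0 <-> x \in S.
Proof.
rewrite -(linear0 (quot_pi S)); split; first by move/quot_piP; rewrite subr0.
by move=> Sx; apply/quot_piP; rewrite subr0.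
Qed.

Lemma lin_factor_surj U V W (p : {linear U -> V}) (f : {linear U -> W}) :
  (forall y, exists x, p x = y) -> (forall x, p x = 0 -> f x = 0) ->
  exists g : {linear V -> W}, forall x, g (p x) = f x.
Proof.
move=> /choice[s ps] pf.
have fs x y : p x = y -> f x = f (s y).
  move=> pxy; apply/eqP; rewrite -subr_eq0 -linearB; apply/eqP/pf.
  by rewrite linearB pxy ps subrr.
have g_lin : linear (f \o s).
  move=> a x y; rewrite /= -linearP; symmetry; apply: fs.
  by rewrite linearP !ps.
by exists (mk_lin g_lin) => x; symmetry; exact: fs.
Qed.

Lemma lin_factor_inj U V W (j : {linear V -> U}) (f : {linear W -> U}) :
  injective j -> (forall x, exists y, j y = f x) ->
  exists g : {linear W -> V}, forall x, j (g x) = f x.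
Proof.
move=> j_inj /choice[g jg].
have g_lin : linear g by move=> a x y; apply: j_inj; rewrite linearP !jg linearP.
by exists (mk_lin g_lin) => x; rewrite mk_linE.
Qed.

(** Injectivity of E, applied to the monomorphism induced by f on the quotient
    by its kernel. *)
Lemma injective_factor (E : lmodType R) (E_inj : injective_mod E) U V
    (f : {linear U -> V}) (h : {linear U -> E}) :
  (forall x, f x = 0 -> h x = 0) ->
  exists k : {linear V -> E}, forall x, k (f x) = h x.
Proof.
move=> fh; pose Q := quotmod (in_kernel f).
have f0 x : x \in in_kernel f -> f x = 0 by move=> /eqP.
have h0 x : x \in in_kernel f -> h x = 0 by move/f0/fh.
have [|k kE] := E_inj _ _ (quot_lift f0) (quot_lift h0).
  apply/linear_injP => z; have [x <-] := quot_pi_surj z.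
  by rewrite quot_liftE => fx; apply/quot_pi_eq0/eqP.
exists k => x; have := kE (quot_pi _ x).
by rewrite !quot_liftE.
Qed.

Lemma kernel_val_is_linear U V (f : {linear U -> V}) :
  linear (@kernel_val R U V f).
Proof. by []. Qed.

Definition kernel_incl U V (f : {linear U -> V}) : {linear kernel f -> U} :=
  mk_lin (@kernel_val_is_linear U V f).

Lemma kernel_inclK U V (f : {linear U -> V}) x : f (kernel_incl f x) = 0.
Proof. by case: x => x /= /eqP. Qed.

Lemma kernel_incl_inj U V (f : {linear U -> V}) : injective (kernel_incl f).
Proof. exact: val_inj. Qed.

Lemma kernel_incl_surj U V (f : {linear U -> V}) x :
  f x = 0 -> exists y, kernel_incl f y = x.
Proof. by move=> /eqP fx; exists (Kernel (fx : x \in in_kernel f)). Qed.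

Lemma boundaryP U V W (f : {linear U -> V}) (g : {linear V -> W}) z :
  z \in @boundary R U V W f g <-> exists x, f x = kernel_incl g z.
Proof. by split=> [/asboolP|?] //; apply/asboolP. Qed.

End FactorThrough.

(** * Finitely generated modules over a noetherian ring *)

Section FinGen.
Variable R : comPzRingType.
Implicit Types U V W : lmodType R.

(** Being a linear combination of the entries of s, in a form suited to
    induction on s; [lincombP] compares it with indexed sums. *)
Fixpoint lincomb V (s : seq V) (x : V) : Prop :=
  if s is y :: s' then exists a : R, lincomb s' (x - a *: y) else x = 0.

Lemma lincombP V (s : seq V) x :
  lincomb s x <-> exists a : 'I_(size s) -> R, x = \sum_(i < size s) a i *: s`_i.
Proof.
elim: s x => [|y s IHs] x /=.
  split=> [->|[a ->]]; last by rewrite big_ord0.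
  by exists (fun=> 0); rewrite big_ord0.
split=> [[b /IHs[a xE]]|[a ->]].
  exists (fun i => if unlift ord0 i is Some j then a j else b).
  rewrite big_ord_recl unlift_none /= -[LHS](subrK (b *: y)) addrC xE.
  by congr (_ + _); apply: eq_bigr => i _; rewrite liftK.
exists (a ord0); apply/IHs; exists (fun i => a (lift ord0 i)).
by rewrite big_ord_recl /= addrC addKr.
Qed.

Lemma lincombDZ V (s : seq V) a x y :
  lincomb s x -> lincomb s y -> lincomb s (a *: x + y).
Proof.
elim: s x y => [|z s IHs] x y /=; first by move=> -> ->; rewrite scaler0 addr0.
move=> [b sx] [c sy]; exists (a * b + c).
rewrite scalerDl -scalerA opprD addrACA -scalerBr.
exact: IHs.
Qed.

Lemma lincomb0 V (s : seq V) : lincomb s 0.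
Proof. by elim: s => //= y s IHs; exists 0; rewrite scale0r subr0. Qed.

Lemma lincomb_mem V (s : seq V) x : x \in s -> lincomb s x.
Proof.
elim: s => //= y s IHs; rewrite inE => /predU1P[->|/IHs sx].
  by exists 1; rewrite scale1r subrr; exact: lincomb0.
by exists 0; rewrite scale0r subr0.
Qed.

Lemma lincomb_min V (S : submodClosed V) s :
  {subset s <= S} -> forall x, lincomb s x -> x \in S.
Proof.
elim: s => [|y s IHs] sS x /=; first by move=> ->; exact: rpred0.
move=> [a]; have /IHs/[apply] : {subset s <= S}.
  by move=> z zs; apply: sS; rewrite inE zs orbT.
by move=> xS; rewrite -(subrK (a *: y) x) rpredD // rpredZ // sS ?mem_head.
Qed.

Lemma lincomb_cat V (s t : seq V) x y :
  lincomb s x -> lincomb t y -> lincomb (s ++ t) (x + y).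
Proof.
elim: s x => [|z s IHs] x /=; first by move=> ->; rewrite add0r.
by move=> [a sx] ty; exists a; rewrite addrAC; exact: IHs.
Qed.

Definition mk_submod V (P : V -> Prop)
    (P_closed : submod_closed (fun x => `[< P x >])) :
  submodClosed V :=
  HB.pack (fun x => `[< P x >]) (GRing.isSubmodClosed.Build R V _ P_closed).

Lemma submod_closedP V (P : V -> Prop) :
  P 0 -> (forall a x y, P x -> P y -> P (a *: x + y)) ->
  submod_closed (fun x => `[< P x >]).
Proof.
move=> P0 PD; split=> [|a x y]; first exact/asboolP.
by move=> /asboolP Px /asboolP Py; apply/asboolP/PD.
Qed.

Lemma in_mk_submod V (P : V -> Prop) P_closed x :
  x \in @mk_submod V P P_closed <-> P x.
Proof. by split=> /asboolP. Qed.

Definition fg_submod V (P : V -> Prop) : Prop :=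
  exists s : seq V, forall x, P x <-> lincomb s x.

Lemma fin_genP V : fin_gen V <-> exists s : seq V, forall x, lincomb s x.
Proof.
split=> [[s [_ sV]]|[s sV]]; exists s.
  by move=> x; apply/lincombP/sV.
by split=> // x _; apply/lincombP.
Qed.

Hypothesis R_noeth : noetherian R.

(** Induction on the generators s of the ambient module: the coefficients with
    which the first generator occurs in P form an ideal, lifts of finitely
    many generators of that ideal reduce any element of P to the span of the
    remaining generators, and the part of P in that span is handled by
    induction. *)
Lemma noetherian_submod V (s : seq V) (P : V -> Prop) :
  P 0 -> (forall a x y, P x -> P y -> P (a *: x + y)) ->
  (forall x, P x -> lincomb s x) -> fg_submod P.
Proof.
elim: s P => [|y s IHs] P P0 PD Ps.
  by exists [::] => x; split=> [/Ps//|/= ->].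
(* The ideal of the coefficients of y in the elements of P. *)
pose lead (a : R^o) := exists2 x, P x & lincomb s (x - a *: y).
have lead_closed : submod_closed (fun a => `[< lead a >]).
  apply: submod_closedP => [|a b c [x Px sx] [z Pz sz]].
    by exists 0; rewrite // scale0r subr0; exact: lincomb0.
  exists (a *: x + z); first exact: PD.
  rewrite scalerDl -scalerA opprD addrACA -scalerBr.
  exact: lincombDZ.
have [t [t_sub t_gen]] := R_noeth (mk_submod lead_closed).
have /choice[g gP] : forall i : 'I_(size t),
    exists x, P x /\ lincomb s (x - (t`_i : R) *: y).
  move=> i; have /in_mk_submod[x Px sx] := t_sub _ (mem_nth 0 (ltn_ord i)).
  by exists x.
have [|||u uP] := IHs (fun x => P x /\ lincomb s x).
- by split=> //; exact: lincomb0.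
- by move=> a x z [Px sx] [Pz sz]; split; [exact: PD | exact: lincombDZ].
- by move=> x [].
have PZ a x : P x -> P (a *: x) by move=> Px; rewrite -[_ *: _]addr0; exact: PD.
have PB x z : P x -> P z -> P (x - z).
  by move=> Px Pz; rewrite addrC -scaleN1r; exact: PD.
exists (map g (enum 'I_(size t)) ++ u) => x; split=> [Px|]; last first.
  have P_closed : submod_closed (fun x => `[< P x >]) by exact: submod_closedP.
  move=> /(@lincomb_min V (mk_submod P_closed)) H; apply/in_mk_submod/H => z.
  rewrite mem_cat => /orP[/mapP[i _ ->]|/lincomb_mem/uP[? _]]; apply/in_mk_submod => //.
  by have [] := gP i.
have [a xa] := Ps x Px.
have /t_gen[b aE] : (a : R^o) \in mk_submod lead_closed.
  by apply/in_mk_submod; exists x.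
pose z := \sum_(i < size t) b i *: g i.
have Pz : P z.
  by rewrite /z; elim/big_rec: _ => // i w _ Pw; apply: PD => //; case: (gP i).
have sz : lincomb s (z - (a : R) *: y).
  have -> : z - (a : R) *: y = \sum_(i < size t) b i *: (g i - (t`_i : R) *: y).
    rewrite aE scaler_suml -sumrB; apply: eq_bigr => i _.
    by rewrite scalerBr scalerA.
  elim/big_rec: _ => [|i w _ sw]; first exact: lincomb0.
  by apply: lincombDZ => //; case: (gP i).
rewrite -[x](subrK z) addrC; apply: lincomb_cat.
  have S_closed : submod_closed
      (fun x => `[< lincomb (map g (enum 'I_(size t))) x >]).
    by apply: submod_closedP; [exact: lincomb0 | move=> *; exact: lincombDZ].
  apply/(in_mk_submod S_closed)/rpred_sum => i _; apply/rpredZ/in_mk_submod.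
  by apply/lincomb_mem/map_f; rewrite mem_enum.
apply/uP; split; first exact: PB.
have -> : x - z = -1 *: (z - (a : R) *: y) + (x - a *: y).
  by rewrite scaleN1r opprB [RHS]addrC addrA subrK.
exact: lincombDZ.
Qed.

Lemma fin_gen_inj U V (j : {linear U -> V}) :
  injective j -> fin_gen V -> fin_gen U.
Proof.
move=> j_inj /fin_genP[s sV]; apply/fin_genP.
have [|||t tP] := @noetherian_submod V s (fun y => exists x, j x = y).
- by exists 0; rewrite linear0.
- by move=> a _ _ [x <-] [y <-]; exists (a *: x + y); rewrite linearP.
- by [].
have /choice[g gP] : forall y, exists x, y \in t -> j x = y.
  move=> y; have [/lincomb_mem/tP[x jx]|] := boolP (y \in t); first by exists x.
  by exists 0.
exists (map g t) => x; have /tP : exists x', j x' = j x by exists x.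
elim: t {tP} gP x => [|y t IHt] gP x /=.
  by rewrite -(linear0 j) => /j_inj.
move=> [a ta]; exists a; apply: IHt => [z zt|].
  by apply: gP; rewrite inE zt orbT.
by rewrite linearB linearZ gP ?mem_head.
Qed.

Lemma fin_gen_surj U V (p : {linear U -> V}) :
  (forall y, exists x, p x = y) -> fin_gen U -> fin_gen V.
Proof.
move=> p_surj /fin_genP[s sU]; apply/fin_genP; exists (map p s) => y.
have [x <-] := p_surj y; move: (sU x); elim: s {sU} x => [|z s IHs] x /=.
  by move=> ->; rewrite linear0.
by move=> [a /IHs]; rewrite linearB linearZ => ?; exists a.
Qed.

End FinGen.

(** * Tensor products *)

Section TensorTheory.
Variable R : comPzRingType.
Implicit Types U V W A B K T : lmodType R.

(** The elements satisfying P form a submodule, and the projection modulo that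
    submodule vanishes on pure tensors, hence everywhere. *)
Lemma tensor_ind U V (P : tensor U V -> Prop) :
  P 0 -> (forall a x y, P x -> P y -> P (a *: x + y)) ->
  (forall u v, P (tens u v)) -> forall z, P z.
Proof.
move=> P0 PD Pt z; have P_closed := submod_closedP P0 PD.
apply/(in_mk_submod P_closed)/quot_pi_eq0.
have : quot_pi (mk_submod P_closed)
    = 0 :> {linear tensor U V -> quotmod (mk_submod P_closed)}.
  by apply: tensor_ext => u v; apply/quot_pi_eq0/in_mk_submod.
by move=> /(congr1 (fun f : {linear _ -> _} => f z)).
Qed.

Definition mk_bilin U V W (b : U -> V -> W) (b_linr : forall u, linear (b u))
    (b_linl : forall v, linear (b^~ v)) : {linear U -> {linear V -> W}}.
Proof.
apply: (@mk_lin R U {linear V -> W} (fun u => mk_lin (b_linr u))) => a u u'.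
by apply: linear_ext => v; rewrite lin_addE lin_scaleE !mk_linE b_linl.
Defined.

Lemma tens_linr U V (u : U) : linear (@tens R U V u).
Proof. by move=> a v w; rewrite tensDr tensZr. Qed.
Lemma tens_linl U V (v : V) : linear (@tens R U V ^~ v).
Proof. by move=> a u w; rewrite tensDl tensZl. Qed.

Definition tens_bilin U V : {linear U -> {linear V -> tensor U V}} :=
  mk_bilin (@tens_linr U V) (@tens_linl U V).

Lemma tens_suml U V J (r : seq J) (f : J -> U) (v : V) :
  tens (\sum_(j <- r) f j) v = \sum_(j <- r) tens (f j) v.
Proof. exact: (linear_sum (mk_lin (tens_linl v))). Qed.
Lemma tens_sumr U V J (r : seq J) (u : U) (f : J -> V) :
  tens u (\sum_(j <- r) f j) = \sum_(j <- r) tens u (f j).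
Proof. exact: (linear_sum (mk_lin (tens_linr u))). Qed.

Definition tmapr U V V' (g : {linear V -> V'}) : {linear tensor U V -> tensor U V'} :=
  tensor_map (lin_id U) g.
Definition tmapl V U U' (f : {linear U -> U'}) : {linear tensor U V -> tensor U' V} :=
  tensor_map f (lin_id V).

Lemma tmaprE U V V' (g : {linear V -> V'}) u v : tmapr U g (tens u v) = tens u (g v).
Proof. exact: tensor_mapE. Qed.
Lemma tmaplE V U U' (f : {linear U -> U'}) u v : tmapl V f (tens u v) = tens (f u) v.
Proof. exact: tensor_mapE. Qed.

Lemma tensor_eq U V W (f g : {linear tensor U V -> W}) :
  (forall u v, f (tens u v) = g (tens u v)) -> forall z, f z = g z.
Proof. by move=> /tensor_ext ->. Qed.

Lemma tmapr_id U V z : tmapr U (lin_id V) z = z.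
Proof. by apply: (tensor_eq (g := lin_id _)) => u v; rewrite tmaprE. Qed.

Lemma tmapr_comp U V V' V'' (g : {linear V' -> V''}) (f : {linear V -> V'}) z :
  tmapr U (lin_comp g f) z = tmapr U g (tmapr U f z).
Proof.
apply: (tensor_eq (g := lin_comp (tmapr U g) (tmapr U f))) => u v.
by rewrite !(lin_compE, tmaprE).
Qed.

Lemma tmapl_comp V U U' U'' (g : {linear U' -> U''}) (f : {linear U -> U'}) z :
  tmapl V (lin_comp g f) z = tmapl V g (tmapl V f z).
Proof.
apply: (tensor_eq (g := lin_comp (tmapl V g) (tmapl V f))) => u v.
by rewrite !(lin_compE, tmaplE).
Qed.

Lemma tmap_swap U U' V V' (f : {linear U -> U'}) (g : {linear V -> V'}) z :
  tmapl V' f (tmapr U g z) = tmapr U' g (tmapl V f z).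
Proof.
apply: (tensor_eq (f := lin_comp (tmapl V' f) (tmapr U g))
                  (g := lin_comp (tmapr U' g) (tmapl V f))) => u v.
by rewrite !(lin_compE, tmaplE, tmaprE).
Qed.

Lemma tmaprD U V V' (f g : {linear V -> V'}) z :
  tmapr U (f + g) z = tmapr U f z + tmapr U g z.
Proof.
apply: (tensor_eq (g := tmapr U f + tmapr U g)) => u v.
by rewrite lin_addE !tmaprE lin_addE tensDr.
Qed.
Lemma tmaprN U V V' (f : {linear V -> V'}) z : tmapr U (- f) z = - tmapr U f z.
Proof.
apply: (tensor_eq (g := - tmapr U f)) => u v.
by rewrite lin_oppE !tmaprE lin_oppE -scaleN1r tensZr scaleN1r.
Qed.

Lemma tmapr_bij U V V' (g : {linear V -> V'}) : bijective g -> bijective (tmapr U g).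
Proof.
move=> g_bij; have [h [gK hK]] := lin_inv g_bij.
exists (tmapr U h) => z; rewrite -tmapr_comp -[RHS](tmapr_id z);
  congr (tmapr U _ z); apply: linear_ext => x.
  by rewrite lin_compE gK.
by rewrite lin_compE hK.
Qed.

Definition tswap U V : {linear tensor U V -> tensor V U}.
Proof.
apply: tensor_lift; apply: (@mk_bilin U V _ (fun u v => tens v u)).
  by move=> u; exact: tens_linl.
by move=> v; exact: tens_linr.
Defined.

Lemma tswapE U V u v : tswap U V (tens u v) = tens v u.
Proof. exact: tensor_liftE. Qed.

Lemma tswapK U V z : tswap V U (tswap U V z) = z.
Proof.
apply: (tensor_eq (f := lin_comp (tswap V U) (tswap U V)) (g := lin_id _)) => u v.
by rewrite lin_compE !tswapE.
Qed.

Lemma tswap_tmapr U V V' (g : {linear V -> V'}) z :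
  tswap U V' (tmapr U g z) = tmapl U g (tswap U V z).
Proof.
apply: (tensor_eq (f := lin_comp (tswap U V') (tmapr U g))
                  (g := lin_comp (tmapl U g) (tswap U V))) => u v.
by rewrite !(lin_compE, tmaprE, tswapE, tmaplE).
Qed.

(** ** Right exactness *)

Lemma tmapl_surj V U U' (p : {linear U -> U'}) :
  (forall y, exists x, p x = y) -> forall z, exists w, tmapl V p w = z.
Proof.
move=> p_surj; apply: tensor_ind => [|a z z' [w <-] [w' <-]|u v].
- by exists 0; rewrite linear0.
- by exists (a *: w + w'); rewrite linearP.
- by have [x <-] := p_surj u; exists (tens x v); rewrite tmaplE.
Qed.

(** The cokernel of K (x) V -> U (x) V receives an inverse to the map onto
   A (x) V: it sends a (x) v to the class of u (x) v for any u over a. *)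
Lemma tmapl_exact V K U A (j : {linear K -> U}) (p : {linear U -> A}) :
  (forall y, exists x, p x = y) -> (forall x, p x = 0 -> exists k, j k = x) ->
  forall z, tmapl V p z = 0 -> exists w, tmapl V j w = z.
Proof.
move=> p_surj pj z pz.
have S_closed : submod_closed (fun z => `[< exists w, tmapl V j w = z >]).
  apply: submod_closedP => [|a x y [w <-] [w' <-]]; first by exists 0; rewrite linear0.
  by exists (a *: w + w'); rewrite linearP.
pose S := mk_submod S_closed.
pose b : {linear U -> {linear V -> quotmod S}} :=
  lin_comp (hom_post V (quot_pi S)) (tens_bilin U V).
have bE u v : b u v = quot_pi S (tens u v) by [].
have [|c cE] := lin_factor_surj (f := b) p_surj.
  move=> x /pj[k <-]; apply: linear_ext => v; rewrite bE; apply/quot_pi_eq0.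
  by apply/in_mk_submod; exists (tens k v); rewrite tmaplE.
apply/(in_mk_submod S_closed)/(quot_pi_eq0 S).
rewrite -[LHS]/(lin_comp (quot_pi S) (lin_id _) z).
have -> : lin_comp (quot_pi S) (lin_id _) = lin_comp (tensor_lift c) (tmapl V p).
  by apply: tensor_ext => u v; rewrite !lin_compE tmaplE tensor_liftE cE bE.
by rewrite lin_compE pz linear0.
Qed.

(** ** Tensor products with free modules *)

(** The power V^n; the free module of rank n is [pw n R^o]. *)
Definition pw n (V : lmodType R) : lmodType R := 'I_n -> V.

Definition pproj n V (i : 'I_n) : {linear pw n V -> V}.
Proof. by apply: (@mk_lin R (pw n V) V (fun r => r i)). Defined.

Definition pinj n V (i : 'I_n) : {linear V -> pw n V}.
Proof.
apply: (@mk_lin R V (pw n V) (fun v j => if j == i then v else 0)) => a x y.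
apply/funext => j; rewrite -[RHS]/(a *: (if j == i then x else 0) + _).
by case: ifP => _ //; rewrite scaler0 addr0.
Defined.

Lemma pinjE n V (i j : 'I_n) (v : V) : pinj V i v j = if j == i then v else 0.
Proof. by []. Qed.

Lemma psumE n V J (s : seq J) (f : J -> pw n V) i :
  (\sum_(j <- s) f j) i = \sum_(j <- s) f j i.
Proof. exact: (linear_sum (pproj V i)). Qed.

Lemma big_only n V (i : 'I_n) (f : 'I_n -> V) :
  (forall j, j != i -> f j = 0) -> \sum_(j < n) f j = f i.
Proof. by move=> f0; rewrite (bigD1 i) //= big1 ?addr0. Qed.

Lemma pinj_sum n V (r : pw n V) : r = \sum_(i < n) pinj V i (r i).
Proof.
apply/funext => j; rewrite psumE (big_only (i := j)) ?pinjE ?eqxx // => i ij.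
by rewrite pinjE eq_sym (negbTE ij).
Qed.

Definition pbase n (i : 'I_n) : pw n R^o := pinj R^o i 1.

Lemma pbaseE n (i j : 'I_n) : pbase i j = if j == i then 1 else 0.
Proof. by []. Qed.

Lemma pbase_sum n (r : pw n R^o) : r = \sum_(i < n) (r i : R) *: pbase i.
Proof.
rewrite {1}(pinj_sum r); apply: eq_bigr => i _.
by rewrite -linearZ; congr (pinj _ _ _); rewrite /GRing.scale /= mulr1.
Qed.

Definition pcomb n V (s : pw n V) : {linear pw n R^o -> V}.
Proof.
apply: (@mk_lin R (pw n R^o) V (fun r => \sum_(i < n) (r i : R) *: s i)) => a x y.
rewrite scaler_sumr -big_split; apply: eq_bigr => i _ /=.
by rewrite scalerA -scalerDl.
Defined.

Lemma pcombE n V (s : pw n V) r : pcomb s r = \sum_(i < n) (r i : R) *: s i.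
Proof. by []. Qed.

Lemma pcomb_base n V (s : pw n V) i : pcomb s (pbase i) = s i.
Proof.
rewrite pcombE (big_only (i := i)) => [|j ji]; first by rewrite pbaseE eqxx scale1r.
by rewrite pbaseE (negbTE ji) scale0r.
Qed.

Lemma pw_ext n V (f g : {linear pw n R^o -> V}) :
  (forall i, f (pbase i) = g (pbase i)) -> f = g.
Proof.
move=> fg; apply: linear_ext => r; rewrite (pbase_sum r) !linear_sum.
by apply: eq_bigr => i _; rewrite !linearZ fg.
Qed.

Lemma fin_gen_pcomb V : fin_gen V ->
  exists n (s : pw n V), forall v, exists r, pcomb s r = v.
Proof.
move=> [s [_ sV]]; exists (size s), (fun i => s`_i) => v.
by have [a ->] := sV v isT; exists a.
Qed.

Lemma fin_gen_pw n V : fin_gen V -> fin_gen (pw n V).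
Proof.
move=> /fin_genP[s sV]; apply/fin_genP.
pose t := [seq pinj V i v | i <- enum 'I_n, v <- s]; exists t => r.
have t_closed : submod_closed (fun x => `[< lincomb t x >]).
  by apply: submod_closedP => [|*]; [exact: lincomb0 | exact: lincombDZ].
apply/(in_mk_submod t_closed); rewrite (pinj_sum r); apply: rpred_sum => i _.
have i_closed : submod_closed (fun v => `[< lincomb t (pinj V i v) >]).
  apply: submod_closedP => [|a x y tx ty]; rewrite ?linear0 ?linearP.
    exact: lincomb0.
  exact: lincombDZ.
apply/in_mk_submod/(in_mk_submod i_closed).
apply: (lincomb_min (s := s)) => // v sv; apply/in_mk_submod/lincomb_mem.
by apply/allpairsP; exists (i, v); rewrite mem_enum.
Qed.

Lemma fin_gen_reg : fin_gen R^o.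
Proof.
apply/fin_genP; exists [:: 1] => x /=; exists x.
by rewrite /GRing.scale /= mulr1 subrr.
Qed.

Definition scal U : {linear tensor R^o U -> U}.
Proof.
apply: tensor_lift; apply: (@mk_bilin R^o U U (fun r u => (r : R) *: u)).
  by move=> r a u v; rewrite scalerDr !scalerA mulrC.
by move=> u a r s; rewrite scalerDl scalerA.
Defined.

Lemma scalE U r u : scal U (tens r u) = (r : R) *: u.
Proof. exact: tensor_liftE. Qed.

(** The i-th coordinate under R^n (x) V = V^n. *)
Definition tcoord n V (i : 'I_n) : {linear tensor (pw n R^o) V -> V} :=
  lin_comp (scal V) (tmapl V (pproj R^o i)).

Lemma tcoordE n V (i : 'I_n) r v : tcoord V i (tens r v) = (r i : R) *: v.
Proof. by rewrite lin_compE tmaplE scalE. Qed.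

Lemma tcoord_sum n V z : z = \sum_(i < n) tens (pbase i) (tcoord V i z).
Proof.
pose f := \sum_(i < n) lin_comp (tens_bilin _ V (pbase i)) (tcoord V i).
have -> : \sum_(i < n) tens (pbase i) (tcoord V i z) = f z.
  by rewrite lin_sumE; apply: eq_bigr => i _.
rewrite -[LHS]/(lin_id _ z); apply: tensor_eq => r v.
rewrite lin_sumE {1}(pbase_sum r) -[LHS]/(tens _ _) tens_suml.
by apply: eq_bigr => i _; rewrite lin_compE tcoordE tensZl -tensZr.
Qed.

Lemma tcoord_base n V (i j : 'I_n) v :
  tcoord V i (tens (pbase j) v) = if i == j then v else 0.
Proof. by rewrite tcoordE pbaseE; case: eqP => _; rewrite ?scale1r ?scale0r. Qed.

Lemma tcoord_sum_base n V (i : 'I_n) (v : pw n V) :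
  tcoord V i (\sum_(j < n) tens (pbase j) (v j)) = v i.
Proof.
rewrite linear_sum (big_only (i := i)) => [|j ji]; first by rewrite tcoord_base eqxx.
by rewrite tcoord_base eq_sym (negbTE ji).
Qed.

Lemma tcoord_inj n V (z : tensor (pw n R^o) V) : (forall i, tcoord V i z = 0) -> z = 0.
Proof.
by move=> z0; rewrite (tcoord_sum z) big1 // => i _; rewrite z0 tens0r.
Qed.

Lemma tcoord_tmapr n V W (f : {linear V -> W}) (i : 'I_n) z :
  tcoord W i (tmapr _ f z) = f (tcoord V i z).
Proof.
apply: (tensor_eq (f := lin_comp (tcoord W i) (tmapr _ f))
                  (g := lin_comp f (tcoord V i))) => r v.
by rewrite lin_compE tmaprE [RHS]lin_compE !tcoordE linearZ.
Qed.

End TensorTheory.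

(** * Tensor evaluation *)

Section TensorEvaluation.
Variable R : comPzRingType.
Implicit Types A B E T : lmodType R.

Lemma hom_preE A B E (f : {linear A -> B}) (h : {linear B -> E}) x :
  hom_pre E f h x = h (f x).
Proof. by []. Qed.
Lemma hom_postE A B E (f : {linear A -> B}) (h : {linear E -> A}) x :
  hom_post E f h x = f (h x).
Proof. by []. Qed.

Definition teval_bil A B E (a : A) (f : {linear B -> E}) :
  {linear {linear A -> B} -> E}.
Proof.
by apply: (@mk_lin R {linear A -> B} E (fun g => f (g a))) => r g h; rewrite linearP.
Defined.

Definition teval A B E :
  {linear tensor A {linear B -> E} -> {linear {linear A -> B} -> E}}.
Proof.
apply: tensor_lift; apply: (@mk_bilin R A {linear B -> E} _ (@teval_bil A B E)).
  by move=> a r f g; apply: linear_ext => h.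
by move=> f r a b; apply: linear_ext => h; rewrite /= !linearP.
Defined.

Lemma tevalE A B E a (f : {linear B -> E}) g : teval A B E (tens a f) g = f (g a).
Proof. by rewrite /teval tensor_liftE. Qed.

Lemma tensor_eq2 A B (V W : lmodType R)
    (f g : {linear tensor A B -> {linear V -> W}}) :
  (forall a b v, f (tens a b) v = g (tens a b) v) -> forall z v, f z v = g z v.
Proof.
move=> fg z v; suff -> : f = g by [].
apply: tensor_ext => a b.
by apply: linear_ext => w; exact: fg.
Qed.

Lemma teval_natl A A' B E (p : {linear A -> A'}) z g :
  teval A' B E (tmapl _ p z) g = teval A B E z (lin_comp g p).
Proof.
apply: (tensor_eq2 (f := lin_comp (teval A' B E) (tmapl _ p))
          (g := lin_comp (hom_pre E (hom_pre B p)) (teval A B E))) => a f h.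
by rewrite !lin_compE tmaplE !(hom_preE, tevalE).
Qed.

Lemma teval_natr A B B' E (d : {linear B -> B'}) z g :
  teval A B E (tmapr A (hom_pre E d) z) g = teval A B' E z (lin_comp d g).
Proof.
apply: (tensor_eq2 (f := lin_comp (teval A B E) (tmapr A (hom_pre E d)))
          (g := lin_comp (hom_pre E (hom_post A d)) (teval A B' E))) => a f h.
by rewrite !lin_compE tmaprE !(hom_preE, hom_postE, tevalE).
Qed.

(** Hom(R^n, B) is B^n; this is the inclusion of the i-th factor. *)
Definition pcol n B (i : 'I_n) : {linear B -> {linear pw n R^o -> B}}.
Proof.
apply: (@mk_bilin R B (pw n R^o) B (fun b r => (r i : R) *: b)).
  by move=> b a r s; rewrite -[(_ + _) i]/(a * r i + s i) scalerDl scalerA.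
by move=> r a b c; rewrite scalerDr !scalerA mulrC.
Defined.

Lemma pcolE n B (i : 'I_n) b r : pcol B i b r = (r i : R) *: b.
Proof. by []. Qed.

Lemma pcol_sum n B (g : {linear pw n R^o -> B}) :
  \sum_(i < n) pcol B i (g (pbase R i)) = g.
Proof.
apply: linear_ext => r; rewrite lin_sumE {2}(pbase_sum r) linear_sum.
by apply: eq_bigr => i _; rewrite pcolE linearZ.
Qed.

Lemma teval_free n B E : bijective (teval (pw n R^o) B E).
Proof.
apply: linear_bij => [z z0|h].
  apply: tcoord_inj => i; apply: linear_ext => b.
  transitivity (teval (pw n R^o) B E z (pcol B i b)); last by rewrite z0.
  apply: (tensor_eq2 (f := tcoord _ i)
            (g := lin_comp (hom_pre E (pcol B i)) (teval (pw n R^o) B E))) => r f c.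
  by rewrite tcoordE lin_compE hom_preE tevalE pcolE linearZ.
exists (\sum_(i < n) tens (pbase R i) (lin_comp h (pcol B i))).
apply: linear_ext => g; rewrite linear_sum lin_sumE -[in RHS](pcol_sum g) linear_sum.
by apply: eq_bigr => i _; rewrite tevalE.
Qed.

(** For a surjection R^n -> A, a functional on Hom(A, B) extends along the
    inclusion into Hom(R^n, B), where it is an evaluation. *)
Lemma teval_surj A B E : fin_gen A -> injective_mod E ->
  forall h, exists z, teval A B E z = h.
Proof.
move=> /fin_gen_pcomb[n [s s_surj]] E_inj h.
have [|k kE] := E_inj _ _ (hom_pre B (pcomb s)) h.
  move=> f g fg; apply: linear_ext => a; have [r <-] := s_surj a.
  by have /(congr1 (fun u : {linear _ -> _} => u r)) := fg.
have [w wk] := bij_surj (teval_free n B E) k.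
by exists (tmapl _ (pcomb s) w); apply: linear_ext => g; rewrite teval_natl wk kE.
Qed.

Hypothesis R_noeth : noetherian R.

(** Injectivity uses that the kernel K of R^n -> A is finitely generated too:
    surjectivity of evaluation for K shows that an element of
    R^n (x) Hom(B, E) mapping to zero comes from K (x) Hom(B, E). *)
Lemma teval_bij A B E : fin_gen A -> injective_mod E -> bijective (teval A B E).
Proof.
move=> A_fg E_inj; apply: linear_bij; last exact: teval_surj.
have [n [s s_surj]] := fin_gen_pcomb A_fg.
move=> z z0; have [w wz] := tmapl_surj s_surj z.
pose K := kernel (pcomb s); pose j : {linear K -> _} := kernel_incl (pcomb s).
have K_fg : fin_gen K.
  apply: (fin_gen_inj R_noeth (@kernel_incl_inj _ _ _ (pcomb s))).
  exact: fin_gen_pw (fin_gen_reg R).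
(* The functional of w dies on Hom(A, B), so it factors through the image of
   Hom(R^n, B) in Hom(K, B), and extends to the latter. *)
have [|k kE] := injective_factor E_inj (f := hom_pre B j) (h := teval _ B E w).
  move=> g gj; have [|g' g'E] := lin_factor_surj (f := g) s_surj.
    move=> x /kernel_incl_surj[y <-].
    by have /(congr1 (fun u : {linear _ -> _} => u y)) := gj.
  have -> : g = lin_comp g' (pcomb s).
    by apply: linear_ext => x; rewrite lin_compE g'E.
  by rewrite -teval_natl wz z0.
have [v vk] := teval_surj K_fg E_inj k.
have jv : tmapl _ j v = w.
  apply: (bij_inj (teval_free n B E)); apply: linear_ext => g.
  by rewrite teval_natl vk -kE.
rewrite -wz -jv -tmapl_comp.
have -> : lin_comp (pcomb s) j = 0.
  by apply: linear_ext => x; exact: kernel_inclK.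
have -> : tmapl {linear B -> E} (0 : {linear K -> A}) = 0 :> {linear _ -> _}.
  by apply: tensor_ext => x y; rewrite tmaplE tens0l.
by [].
Qed.

End TensorEvaluation.

(** * Flat modules *)

Section Flat.
Variable R : comPzRingType.
Hypothesis R_noeth : noetherian R.
Implicit Types A B C E P T U V W : lmodType R.

(** Tensoring with T preserves injectivity of maps out of finitely generated
    modules; as tensor products commute with directed unions, this is
    flatness. *)
Definition flat T : Prop := forall U V (j : {linear U -> V}),
  fin_gen U -> injective j -> injective (tmapl T j).

Lemma lin_eq_at U V (f g : {linear U -> V}) : f = g -> forall x, f x = g x.
Proof. by move=> ->. Qed.

Lemma linear_at0 U V (f : {linear U -> V}) x : x = 0 -> f x = 0.
Proof. by move=> ->; rewrite linear0. Qed.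

Lemma flatr T U V (j : {linear U -> V}) :
  flat T -> fin_gen U -> injective j -> injective (tmapr T j).
Proof.
move=> T_flat U_fg j_inj x y xy; have sxy : tswap T U x = tswap T U y.
  apply: (T_flat _ _ j U_fg j_inj).
  by rewrite -[LHS]tswap_tmapr -[RHS]tswap_tmapr xy.
by rewrite -[LHS]tswapK sxy tswapK.
Qed.

Lemma flat_retract T T' (i : {linear T -> T'}) (r : {linear T' -> T}) :
  cancel i r -> flat T' -> flat T.
Proof.
move=> iK T'_flat U V j U_fg j_inj x y xy.
have rK z : tmapr U r (tmapr U i z) = z.
  rewrite -tmapr_comp (_ : lin_comp r i = lin_id T) ?tmapr_id //.
  by apply: linear_ext => t; rewrite lin_compE iK.
have ixy : tmapr U i x = tmapr U i y.
  apply: (T'_flat _ _ j U_fg j_inj).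
  by rewrite [LHS]tmap_swap [RHS]tmap_swap xy.
by rewrite -[LHS]rK ixy rK.
Qed.

Lemma flat_iso T T' : mod_iso T T' -> flat T' -> flat T.
Proof.
move=> [f f_bij]; have [g [fK gK]] := lin_inv f_bij; exact: flat_retract fK.
Qed.

Definition pair_fst T T' : {linear (T * T')%type -> T} :=
  mk_lin ((fun _ _ _ => erefl) : linear (fst : T * T' -> T)).
Definition pair_snd T T' : {linear (T * T')%type -> T'} :=
  mk_lin ((fun _ _ _ => erefl) : linear (snd : T * T' -> T')).

Lemma pair_inl_linear T T' : linear ((fun t => (t, 0)) : T -> T * T').
Proof. by move=> a x y; rewrite -[RHS]/(_, a *: 0 + 0) scaler0 addr0. Qed.
Lemma pair_inr_linear T T' : linear ((fun t => (0, t)) : T' -> T * T').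
Proof. by move=> a x y; rewrite -[RHS]/(a *: 0 + 0, _) scaler0 addr0. Qed.

Definition pair_inl T T' : {linear T -> (T * T')%type} := mk_lin (@pair_inl_linear T T').
Definition pair_inr T T' : {linear T' -> (T * T')%type} := mk_lin (@pair_inr_linear T T').

Lemma flat_pair T T' : flat T -> flat T' -> flat (T * T')%type.
Proof.
move=> T_flat T'_flat U V j U_fg j_inj; apply/linear_injP => z jz.
have z1 : tmapr U (pair_fst T T') z = 0.
  by apply: (T_flat _ _ _ U_fg j_inj); rewrite linear0 tmap_swap jz linear0.
have z2 : tmapr U (pair_snd T T') z = 0.
  by apply: (T'_flat _ _ _ U_fg j_inj); rewrite linear0 tmap_swap jz linear0.
have zE : lin_comp (pair_inl T T') (pair_fst T T')
    + lin_comp (pair_inr T T') (pair_snd T T') = lin_id (T * T')%type.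
  apply: linear_ext => -[x y]; rewrite lin_addE !lin_compE.
  by rewrite -[LHS]/(x + 0, 0 + y) addr0 add0r.
rewrite -[LHS]tmapr_id; apply: etrans (congr1 (fun f => tmapr U f z) (esym zE)) _.
apply: etrans (tmaprD _ _ _) _; rewrite [X in X + _]tmapr_comp [X in _ + X]tmapr_comp.
by rewrite (linear_at0 _ z1) (linear_at0 _ z2) addr0.
Qed.

(** An element of U (x) R^(X) is rebuilt from its coordinates in U, and an
    injective map U -> V is injective on each coordinate. *)
Lemma flat_free (X : choiceType) : flat (freemod R X).
Proof.
move=> U V j _ j_inj; apply/linear_injP => z jz.
have co_lin x : linear ((fun f => (f : freemod R X) x) : freemod R X -> R^o) by [].
pose co x W : {linear tensor W (freemod R X) -> W} :=
  lin_comp (scal W) (lin_comp (tswap W R^o) (tmapr W (mk_lin (co_lin x)))).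
have coE x W w (f : freemod R X) : co x W (tens w f) = (f x : R) *: w.
  by rewrite /co !lin_compE tmaprE tswapE scalE.
pose rebuild (s : {fset X}) : {linear tensor U (freemod R X) -> _} :=
  \sum_(x <- s) lin_comp (mk_lin (tens_linl (freemod_gen R x))) (co x U).
(* The support is stated for all larger finite sets, so that sums of tensors
   are handled by taking unions. *)
have [A AE] : exists A : {fset X}, forall B : {fset X},
    (A `<=` B)%fset -> z = rebuild B z.
  elim/tensor_ind: z {jz} => [|a z z' [A zA] [B zB]|u f].
  - by exists fset0 => B _; rewrite linear0.
  - exists (A `|` B)%fset => D; rewrite fsubUset => /andP[AD BD].
    by rewrite linearP -zA // -zB.
  - have /asboolP/finite_fsetP[A fA] := valP f.
    exists A => B AB; rewrite lin_sumE.
    have f0 x : x \notin B -> f x = 0.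
      move=> xB; have : x \notin A by apply: contra xB; apply/fsubsetP.
      move=> xA; apply/eqP; apply: contraNT xA => fx.
      by move: (fx : [set x | (f : X -> R) x != 0]%classic x); rewrite fA.
    rewrite -{1}(freemod_eta f) -[X in tens u X]/(freemod_lift_fun _ _).
    rewrite (freemod_lift_funE _ f0) tens_sumr; apply: eq_bigr => x _.
    by rewrite lin_compE coE tensZr mk_linE tensZl.
rewrite (AE A) // lin_sumE big1 // => x _; rewrite lin_compE.
have -> : co x U z = 0.
  apply: j_inj; rewrite linear0 -(linear0 (co x V)) -jz.
  apply: (tensor_eq (f := lin_comp j (co x U)) (g := lin_comp (co x V) (tmapl _ j))).
  by move=> u f; rewrite [LHS]lin_compE [RHS]lin_compE tmaplE !coE linearZ.
by rewrite linear0.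
Qed.

(** A projective module is a retract of the free module on its elements. *)
Lemma flat_projective P : projective P -> flat P.
Proof.
move=> P_proj; pose p : {linear freemod R P -> P} := freemod_lift id.
have [|i pi] := P_proj _ _ p (lin_id P).
  by move=> y; exists (freemod_gen R y); rewrite /p freemod_liftE.
exact: (flat_retract (i := i) (r := p)) (@flat_free P).
Qed.

(** U (x) Hom(E, I) is Hom(Hom(U, E), I) for U finitely generated, and maps
    U -> E extend along injections U -> V. *)
Lemma flat_dual E I : injective_mod E -> injective_mod I -> flat {linear E -> I}.
Proof.
move=> E_inj I_inj U V j U_fg j_inj; apply/linear_injP => z jz.
apply: (bij_inj (teval_bij R_noeth E U_fg I_inj)); apply: linear_ext => g.
have [k kE] := E_inj _ _ j g j_inj.
have -> : g = lin_comp k j by apply: linear_ext => u; rewrite lin_compE kE.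
by rewrite -teval_natl jz !linear0.
Qed.

Definition thom T A B : {linear tensor T {linear A -> B} -> {linear A -> tensor T B}}.
Proof.
apply: tensor_lift.
apply: (@mk_bilin R T {linear A -> B} _ (fun t h => lin_comp (tens_bilin T B t) h)).
  by move=> t a g h; apply: linear_ext => x; exact: tens_linr.
by move=> h a t u; apply: linear_ext => x; exact: tens_linl.
Defined.

Lemma thomE T A B t h a : thom T A B (tens t h) a = tens t (h a).
Proof. by rewrite /thom tensor_liftE. Qed.

Lemma thom_nat T A A' B (p : {linear A -> A'}) z a :
  thom T A B (tmapr T (hom_pre B p) z) a = thom T A' B z (p a).
Proof.
apply: (tensor_eq2 (f := lin_comp (thom T A B) (tmapr T (hom_pre B p)))
          (g := lin_comp (hom_pre _ p) (thom T A' B))) => t h x.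
by rewrite !lin_compE tmaprE !(hom_preE, thomE).
Qed.

Lemma thom_free T n B : bijective (thom T (pw n R^o) B).
Proof.
have s_lin : linear (fun u : {linear pw n R^o -> tensor T B} =>
    \sum_(i < n) tmapr T (pcol B i) (u (pbase R i))).
  by move=> a u v; rewrite scaler_sumr -big_split; apply: eq_bigr => i _; rewrite linearP.
pose s := mk_lin s_lin.
have sE u : s u = \sum_(i < n) tmapr T (pcol B i) (u (pbase R i)) by [].
exists s => [z|u].
  apply: (tensor_eq (f := lin_comp s (thom T (pw n R^o) B)) (g := lin_id _)) => t h.
  rewrite lin_compE sE -[RHS]/(tens t h) -{2}(pcol_sum h) tens_sumr.
  by apply: eq_bigr => i _; rewrite thomE tmaprE.
apply: linear_ext => r; rewrite sE linear_sum lin_sumE.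
rewrite (pbase_sum r) [RHS]linear_sum; apply: eq_bigr => i _.
rewrite -pbase_sum linearZ.
apply: (tensor_eq2 (f := lin_comp (thom T (pw n R^o) B) (tmapr T (pcol B i)))
                   (g := pcol (tensor T B) i)) => t b x.
by rewrite lin_compE tmaprE thomE !pcolE tensZr.
Qed.

Lemma hom_pre_inj A A' B (p : {linear A -> A'}) :
  (forall y, exists x, p x = y) -> injective (hom_pre B p).
Proof.
move=> p_surj f g fg; apply: linear_ext => y; have [x <-] := p_surj y.
by have /(congr1 (fun u : {linear _ -> _} => u x)) := fg.
Qed.

Lemma fin_gen_iso U V : mod_iso U V -> fin_gen U -> fin_gen V.
Proof. by move=> [f /bij_surj f_surj]; exact: fin_gen_surj. Qed.

Lemma fin_gen_hom_free n B : fin_gen B -> fin_gen {linear pw n R^o -> B}.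
Proof.
move=> B_fg.
have ev_lin : linear
    (fun g : {linear pw n R^o -> B} => (fun i => g (pbase R i)) : pw n B).
  by move=> a g h; apply/funext.
apply: (fin_gen_inj R_noeth (j := mk_lin ev_lin)); last exact: fin_gen_pw.
move=> g h gh; apply: pw_ext => i.
by have /(congr1 (fun u : pw n B => u i)) := gh.
Qed.

Lemma fin_gen_hom A B : fin_gen A -> fin_gen B -> fin_gen {linear A -> B}.
Proof.
move=> /fin_gen_pcomb[n [s s_surj]] B_fg.
apply: (fin_gen_inj R_noeth (@hom_pre_inj _ _ B _ s_surj)).
exact: fin_gen_hom_free.
Qed.

(** A surjection R^n -> A embeds Hom(A, B) in Hom(R^n, B), where the map is
    bijective, and flatness of T preserves the embedding. *)
Lemma thom_inj T A B : flat T -> fin_gen A -> fin_gen B -> injective (thom T A B).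
Proof.
move=> T_flat A_fg B_fg; have [n [s s_surj]] := fin_gen_pcomb A_fg.
apply/linear_injP => z z0.
apply: (flatr T_flat (fin_gen_hom A_fg B_fg) (@hom_pre_inj _ _ B _ s_surj)).
apply: (bij_inj (thom_free T n B)); apply: linear_ext => r.
rewrite [LHS]thom_nat; apply: etrans (lin_eq_at z0 _) _.
by rewrite !linear0.
Qed.

(** For 0 -> K -> R^n -> A -> 0 exact, a map h : A -> T (x) B comes, as a map
    on R^n, from some w in T (x) Hom(R^n, B).  The restriction of w to K is
    zero by injectivity for K, so flatness of T puts w in
    T (x) Hom(A, B). *)
Lemma thom_bij T A B : flat T -> fin_gen A -> fin_gen B -> bijective (thom T A B).
Proof.
move=> T_flat A_fg B_fg; apply: bij_of_inj_surj; first exact: thom_inj.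
move=> h; have [n [s s_surj]] := fin_gen_pcomb A_fg.
have [w wh] := bij_surj (thom_free T n B) (lin_comp h (pcomb s)).
pose K := kernel (pcomb s); pose j : {linear K -> _} := kernel_incl (pcomb s).
have K_fg : fin_gen K.
  apply: (fin_gen_inj R_noeth (@kernel_incl_inj _ _ _ (pcomb s))).
  exact: fin_gen_pw (fin_gen_reg R).
have jw : tmapr T (hom_pre B j) w = 0.
  apply: (thom_inj T_flat K_fg B_fg); apply: linear_ext => k.
  rewrite [LHS]thom_nat; apply: etrans (lin_eq_at wh _) _.
  by rewrite [LHS]lin_compE kernel_inclK !linear0.
(* Restriction to K factors as a surjection onto D followed by an injection,
   and flatness removes the injection. *)
pose D := quotmod (in_kernel (hom_pre B j)).
pose q : {linear {linear pw n R^o -> B} -> D} := quot_pi _.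
have q_surj y : exists x, q x = y by exact: quot_pi_surj.
have [|i iq] := lin_factor_surj (f := hom_pre B j) q_surj.
  by move=> x /quot_pi_eq0/eqP.
have i_inj : injective i.
  apply/linear_injP => y; have [x <-] := q_surj y.
  by rewrite iq => jx; apply/quot_pi_eq0/eqP.
have qw : tmapr T q w = 0.
  apply: (flatr T_flat (fin_gen_surj q_surj (fin_gen_hom_free n B_fg)) i_inj).
  rewrite linear0 -[LHS]tmapr_comp; apply: etrans jw.
  congr (GRing.Linear.sort (tmapr T _) w).
  by apply: linear_ext => x; rewrite lin_compE iq.
have [||v vw] := tmapl_exact (j := hom_pre B (pcomb s)) q_surj _ (z := tswap _ _ w).
- move=> x /quot_pi_eq0/eqP xj.
  have [|g gE] := lin_factor_surj (f := x) s_surj.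
    move=> r /kernel_incl_surj[y <-]; exact: lin_eq_at xj y.
  by exists g; apply: linear_ext => r; rewrite -gE.
- rewrite -[LHS]tswap_tmapr; exact: linear_at0.
exists (tswap _ _ v); apply: linear_ext => a; have [r <-] := s_surj a.
rewrite -[LHS]thom_nat; apply: etrans (lin_eq_at wh r); congr (thom _ _ _ _ r).
rewrite -[LHS]tswapK -[RHS]tswapK; apply: congr1.
apply: etrans (tswap_tmapr _ _) _; apply: etrans vw.
by congr (GRing.Linear.sort _ _); exact: tswapK.
Qed.

End Flat.

(** * Flat multiples of a semidualizing module *)

Section FlatMultiples.
Variable R : comPzRingType.
Implicit Types M C T U V W X Y Z : lmodType R.

Lemma tensor_eq3 U V W Z (f g : {linear tensor (tensor U V) W -> Z}) :
  (forall u v w, f (tens (tens u v) w) = g (tens (tens u v) w)) ->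
  forall z, f z = g z.
Proof.
move=> fg; apply: tensor_eq => x w.
apply: (tensor_eq (f := lin_comp f (mk_lin (tens_linl w)))
                  (g := lin_comp g (mk_lin (tens_linl w)))) => u v.
exact: fg.
Qed.

Lemma tensor_eq3r U V W Z (f g : {linear tensor U (tensor V W) -> Z}) :
  (forall u v w, f (tens u (tens v w)) = g (tens u (tens v w))) ->
  forall z, f z = g z.
Proof.
move=> fg; apply: tensor_eq => u x.
apply: (tensor_eq (f := lin_comp f (tens_bilin _ _ u))
                  (g := lin_comp g (tens_bilin _ _ u))) => v w.
exact: fg.
Qed.

(** Where this is an isomorphism, M (x) X depends on X through Hom(C, X) only:
    exactness of Hom(C, -) on proper resolutions becomes applicable. *)
Definition tcontract M C X :
  {linear tensor (tensor M C) {linear C -> X} -> tensor M X}.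
Proof.
apply: tensor_lift; apply: tensor_lift.
apply: (@mk_bilin R M C _
  (fun m c => lin_comp (tens_bilin M X m) (teval_bil c (lin_id X)))).
  by move=> m a c c'; apply: linear_ext => h; rewrite [LHS]/= linearP tens_linr.
by move=> c a m m'; apply: linear_ext => h; exact: tens_linl.
Defined.

Lemma tcontractE M C X m c h : tcontract M C X (tens (tens m c) h) = tens m (h c).
Proof. by rewrite /tcontract !tensor_liftE. Qed.

Lemma tcontract_nat M C X Y (d : {linear X -> Y}) z :
  tcontract M C Y (tmapr _ (hom_post C d) z) = tmapr M d (tcontract M C X z).
Proof.
apply: (tensor_eq3 (f := lin_comp (tcontract M C Y) (tmapr _ (hom_post C d)))
                   (g := lin_comp (tmapr M d) (tcontract M C X))) => m c h.
by rewrite !lin_compE tmaprE !tcontractE tmaprE.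
Qed.

Definition tassoc_inv_at M C T (m : M) :
  {linear tensor T C -> tensor (tensor M C) T}.
Proof.
apply: tensor_lift; apply: (@mk_bilin R T C _ (fun t c => tens (tens m c) t)).
  by move=> t a c c'; rewrite tens_linr tens_linl.
by move=> c; exact: tens_linr.
Defined.

Lemma tassoc_inv_atE M C T (m : M) (t : T) (c : C) :
  tassoc_inv_at C T m (tens t c) = tens (tens m c) t.
Proof. exact: tensor_liftE. Qed.

Lemma tassoc_inv_linear M C T : linear (@tassoc_inv_at M C T).
Proof.
move=> a m m'; apply: tensor_ext => t c.
by rewrite lin_addE lin_scaleE !tassoc_inv_atE tens_linl tens_linl.
Qed.

Definition tassoc_inv M C T : {linear tensor M (tensor T C) -> tensor (tensor M C) T} :=
  tensor_lift (mk_lin (@tassoc_inv_linear M C T)).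

Lemma tassoc_invE M C T (m : M) (t : T) (c : C) :
  tassoc_inv M C T (tens m (tens t c)) = tens (tens m c) t.
Proof.
by apply: etrans (tassoc_inv_atE m t c); rewrite /tassoc_inv tensor_liftE.
Qed.

Lemma tcontract_unit_bij M C T :
  bijective (lin_comp (tcontract M C (tensor T C)) (tmapr _ (tens_bilin T C))).
Proof.
set f := lin_comp _ _.
have fE m c t : f (tens (tens m c) t) = tens m (tens t c).
  by rewrite /f lin_compE tmaprE tcontractE.
exists (tassoc_inv M C T) => z.
  apply: (tensor_eq3 (f := lin_comp (tassoc_inv M C T) f) (g := lin_id _)) => m c t.
  by rewrite lin_compE fE tassoc_invE.
apply: (tensor_eq3r (f := lin_comp f (tassoc_inv M C T)) (g := lin_id _)) => m t c.
by rewrite lin_compE tassoc_invE fE.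
Qed.

Hypothesis R_noeth : noetherian R.
Variables (C : lmodType R) (C_sd : semidualizing C).

Lemma tens1_bij T : bijective (mk_lin (tens_linl (1 : R^o)) : {linear T -> _}).
Proof.
exists (lin_comp (scal T) (tswap T R^o)) => [t|z].
  by rewrite lin_compE mk_linE tswapE scalE scale1r.
apply: (tensor_eq (f := lin_comp (mk_lin (tens_linl (1 : R^o)))
                     (lin_comp (scal T) (tswap T R^o))) (g := lin_id _)) => t r.
rewrite 2!lin_compE tswapE scalE mk_linE tensZl -tensZr.
by congr (tens t _); rewrite /GRing.scale /= mulr1.
Qed.

(** The unit is the composite T = T (x) R = T (x) Hom(C, C) = Hom(C, T (x) C). *)
Lemma unit_bij T : flat T -> bijective (tens_bilin T C).
Proof.
case: C_sd => C_fg h_bij _ T_flat.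
have h_lin : linear (@homothety R C : R^o -> _).
  by move=> a r s; apply: linear_ext => c; rewrite /= scalerDl scalerA.
have -> : tens_bilin T C = lin_comp (thom T C C)
    (lin_comp (tmapr T (mk_lin h_lin)) (mk_lin (tens_linl (1 : R^o)))).
  apply: linear_ext => t; apply: linear_ext => c.
  by rewrite 2!lin_compE mk_linE tmaprE thomE /= scale1r.
apply: bij_comp; first exact: thom_bij.
by apply: bij_comp; [exact: tmapr_bij | exact: tens1_bij].
Qed.

Definition flat_multiple X := exists2 T, flat T & mod_iso X (tensor T C).

Lemma in_PC_flat_multiple X : in_PC C X -> flat_multiple X.
Proof. by move=> [P P_proj XP]; exists P => //; exact: flat_projective. Qed.

Lemma hom_post_bij U V W (f : {linear U -> V}) :
  bijective f -> bijective (hom_post W f).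
Proof.
move=> f_bij; have [g [fK gK]] := lin_inv f_bij.
by exists (hom_post W g) => h; apply: linear_ext => x; rewrite !hom_postE.
Qed.

Lemma flat_hom_multiple X : flat_multiple X -> flat {linear C -> X}.
Proof.
move=> [T T_flat [f f_bij]]; apply: flat_iso (T_flat).
apply: (@mod_iso_trans _ {linear C -> tensor T C}).
  by exists (hom_post C f); exact: hom_post_bij.
by apply: mod_iso_sym; exists (tens_bilin T C); exact: unit_bij T_flat.
Qed.

Lemma bij_comp_left (A B D : Type) (f : B -> D) (g : A -> B) :
  bijective g -> bijective (f \o g) -> bijective f.
Proof.
move=> [g' gK g'K] [h hK h'K]; exists (g \o h) => x /=; last exact: h'K.
by rewrite -{1}(g'K x) -[f _]/((f \o g) (g' x)) hK g'K.
Qed.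

(** For X = T (x) C and Hom(C, X) = T this is associativity,
    (M (x) C) (x) T = M (x) (T (x) C). *)
Lemma tcontract_bij M X : flat_multiple X -> bijective (tcontract M C X).
Proof.
move=> [T T_flat [f f_bij]].
have b1 : bijective (tcontract M C (tensor T C)).
  apply: bij_comp_left (tmapr_bij _ (unit_bij T_flat)) _.
  exact: tcontract_unit_bij.
have b2 : bijective (tmapr M f \o tcontract M C X).
  apply: (eq_bij (bij_comp b1 (tmapr_bij (tensor M C) (hom_post_bij C f_bij)))).
  by move=> z; exact: tcontract_nat.
have [g [fK gK]] := lin_inv (tmapr_bij M f_bij).
by apply: (eq_bij (bij_comp (Bijective gK fK) b2)) => z /=; rewrite fK.
Qed.

(** Hom(Hom(C, E), I) is C (x) Hom(E, I) by tensor evaluation. *)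
Lemma dual_IC_flat_multiple X I :
  in_IC C X -> injective_mod I -> flat_multiple {linear X -> I}.
Proof.
case: C_sd => C_fg _ _ [E E_inj X_iso] I_inj.
exists {linear E -> I}; first exact: flat_dual.
apply: mod_iso_trans (mod_iso_hom I (mod_iso_sym X_iso)) _.
apply: (@mod_iso_trans _ (tensor C {linear E -> I})).
  by apply: mod_iso_sym; exists (teval C E I); exact: teval_bij.
by exists (tswap _ _); exists (tswap _ _) => z; exact: tswapK.
Qed.

End FlatMultiples.

(** * Complexes *)

Section Complexes.
Variable R : comPzRingType.
Implicit Types (X Y : chain R) (Z : cochain R) (U V W N I P : lmodType R).

Lemma homology_iso U V W U' V' W' (f : {linear U -> V}) (g : {linear V -> W})
    (f' : {linear U' -> V'}) (g' : {linear V' -> W'}) (a : {linear V -> V'}) :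
  (forall x, g x = 0 -> g' (a x) = 0) ->
  (forall x, g x = 0 -> (exists u, f u = x) <-> (exists u, f' u = a x)) ->
  (forall y, g' y = 0 -> exists x u, g x = 0 /\ a x + f' u = y) ->
  mod_iso (homology_at f g) (homology_at f' g').
Proof.
move=> a_cycle a_bound a_surj.
have [|b bE] := lin_factor_inj (f := lin_comp a (kernel_incl g)) (@kernel_incl_inj _ _ _ g').
  by move=> x; apply: kernel_incl_surj; apply: a_cycle; exact: kernel_inclK.
pose q : {linear kernel g' -> homology_at f' g'} := quot_pi (boundary f' (g := g')).
apply: (quot_mod_iso (f := lin_comp q b)) => [x|y].
  rewrite boundaryP a_bound ?kernel_inclK // lin_compE quot_pi_eq0 boundaryP.
  by rewrite bE.
have [z <-] := quot_pi_surj y.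
have [x [u [gx xz]]] := a_surj _ (kernel_inclK z).
have [w wx] := kernel_incl_surj gx; exists w.
rewrite lin_compE; apply/quot_piP/boundaryP; exists (- u).
by rewrite !linearN linearB bE lin_compE wx -xz opprD addNKr.
Qed.

Lemma chain_exactP X : chain_exact X <->
  forall n x, chain_out X n x = 0 -> exists y, chain_d X n y = x.
Proof.
split=> X_exact n => [x|z].
  move=> /kernel_incl_surj[z <-].
  by have /quot_pi_eq0/boundaryP := X_exact n (quot_pi _ z).
have [x <-] := quot_pi_surj z; apply/quot_pi_eq0/boundaryP.
exact/X_exact/kernel_inclK.
Qed.

Lemma chain_out_d X n x : chain_out X n (chain_d X n x) = 0.
Proof. by case: n x => [|n] x //=; rewrite chain_dd. Qed.

(** ** Chain maps and quasi-isomorphisms *)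

Definition chain_map X Y (f : forall n, {linear X n -> Y n}) : Prop :=
  forall n x, f n (chain_d X n x) = chain_d Y n (f n.+1 x).

Definition quasi_iso X Y (f : forall n, {linear X n -> Y n}) : Prop := forall n,
  (forall x, chain_out X n x = 0 -> (exists y, chain_d Y n y = f n x) ->
     exists y, chain_d X n y = x) /\
  (forall y, chain_out Y n y = 0 ->
     exists x u, chain_out X n x = 0 /\ f n x + chain_d Y n u = y).

Lemma chain_map_out X Y f n x : @chain_map X Y f -> chain_out X n x = 0 ->
  chain_out Y n (f n x) = 0.
Proof. by case: n x => [|n] x //= fd x0; rewrite -fd x0 linear0. Qed.

Lemma quasi_iso_homology X Y f : @chain_map X Y f -> quasi_iso f ->
  forall n, mod_iso (chain_homology X n) (chain_homology Y n).
Proof.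
move=> fd f_qi n; have [f_inj f_surj] := f_qi n.
apply: (homology_iso (a := f n)) => [x|x x0|//].
  exact: chain_map_out.
split=> [[u <-]|]; last exact: f_inj.
by exists (f n.+1 u); rewrite fd.
Qed.

Lemma bij_quasi_iso X Y f : @chain_map X Y f -> (forall n, bijective (f n)) ->
  quasi_iso f.
Proof.
move=> fd f_bij n; split=> [x x0 [y fx]|y y0].
  have [z zy] := bij_surj (f_bij n.+1) y; exists z.
  by apply: (bij_inj (f_bij n)); rewrite fd zy.
have [x xy] := bij_surj (f_bij n) y; exists x, 0; rewrite linear0 addr0; split=> //.
case: n => [|n] in x y xy y0 *; first by [].
by apply: (bij_inj (f_bij n)); rewrite fd xy y0 linear0.
Qed.

Lemma iso_homology X Y f : @chain_map X Y f -> (forall n, bijective (f n)) ->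
  forall n, mod_iso (chain_homology X n) (chain_homology Y n).
Proof. by move=> fd /(bij_quasi_iso fd); exact: quasi_iso_homology. Qed.

(** ** Homotopy equivalences *)

(** A homotopy s from the identity to e.  Degree 0 is separate since the
    complexes are truncated there, and the term s d has no meaning. *)
Definition homotopic_id X (e : forall n, X n -> X n)
    (s : forall n, {linear X n -> X n.+1}) : Prop :=
  (forall x, e 0%N x = x + chain_d X 0 (s 0%N x)) /\
  (forall n x, e n.+1 x = x + chain_d X n.+1 (s n.+1 x) + s n (chain_d X n x)).

Record hequiv X Y := HEquiv {
  he_to : forall n, {linear X n -> Y n};
  he_from : forall n, {linear Y n -> X n};
  he_htyX : forall n, {linear X n -> X n.+1};
  he_htyY : forall n, {linear Y n -> Y n.+1};
  he_to_map : chain_map he_to;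
  he_from_map : chain_map he_from;
  he_homX : homotopic_id (fun n x => he_from n (he_to n x)) he_htyX;
  he_homY : homotopic_id (fun n y => he_to n (he_from n y)) he_htyY
}.

Lemma homotopic_id_cycle X e s n x : @homotopic_id X e s -> chain_out X n x = 0 ->
  e n x = x + chain_d X n (s n x).
Proof.
by case: n x => [|n] x [e0 eS] //= x0; rewrite eS x0 linear0 addr0.
Qed.

Lemma hequiv_homology X Y n : hequiv X Y ->
  mod_iso (chain_homology X n) (chain_homology Y n).
Proof.
case=> f g s t fd gd sX tY; apply: (quasi_iso_homology fd) => {}n.
split=> [x x0 [y fx]|y y0].
  exists (g n.+1 y - s n x); rewrite linearB -gd fx.
  by rewrite (homotopic_id_cycle sX x0) addrK.
exists (g n y), (- t n y); split; first exact: chain_map_out gd y0.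
by rewrite (homotopic_id_cycle tY y0) linearN addrK.
Qed.

Lemma hequiv_tensor X Y V : hequiv X Y -> hequiv (chain_tensor X V) (chain_tensor Y V).
Proof.
case=> f g s t fd gd sX tY.
have tmapd (A B : chain R) (h : forall n, {linear A n -> B n}) : chain_map h ->
    @chain_map (chain_tensor A V) (chain_tensor B V) (fun n => tmapl V (h n)).
  move=> hd n z; apply: (tensor_eq (f := lin_comp (tmapl V (h n)) (tmapl V (chain_d A n)))
    (g := lin_comp (tmapl V (chain_d B n)) (tmapl V (h n.+1)))) => u v.
  by rewrite !lin_compE !tmaplE hd.
have thty (A B : chain R) (f1 : forall n, {linear A n -> B n})
    (g1 : forall n, {linear B n -> A n}) s1 :
    homotopic_id (fun n x => g1 n (f1 n x)) s1 ->
    @homotopic_id (chain_tensor A V)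
      (fun n z => tmapl V (g1 n) (tmapl V (f1 n) z)) (fun n => tmapl V (s1 n)).
  move=> [s0 sS]; split=> [z|n z].
    apply: (tensor_eq (f := lin_comp (tmapl V (g1 0%N)) (tmapl V (f1 0%N)))
      (g := lin_id _ + lin_comp (tmapl V (chain_d A 0)) (tmapl V (s1 0%N)))) => u v.
    rewrite lin_addE !lin_compE !tmaplE s0 tensDl; congr (_ + _).
  apply: (tensor_eq (f := lin_comp (tmapl V (g1 n.+1)) (tmapl V (f1 n.+1)))
    (g := lin_id _ + lin_comp (tmapl V (chain_d A n.+1)) (tmapl V (s1 n.+1))
      + lin_comp (tmapl V (s1 n)) (tmapl V (chain_d A n)))) => u v.
  by rewrite !lin_addE !lin_compE !tmaplE sS !tensDl; congr (_ + _ + _).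
exact: (HEquiv (tmapd _ _ _ fd) (tmapd _ _ _ gd)
  (thty _ _ _ _ _ sX) (thty _ _ _ _ _ tY)).
Qed.

(** The homotopies of X and Y compose with cocycles X n -> N and Y n -> N to
    the coboundaries required. *)
Lemma hequiv_hom X Y N n : hequiv X Y ->
  mod_iso (cochain_cohomology (chain_hom Y N) n) (cochain_cohomology (chain_hom X N) n).
Proof.
case=> f g s t fd gd [s0 sS] [t0 tS].
have cocycle (A : chain R) m (h : {linear A m -> N}) :
    cochain_d (chain_hom A N) m h = 0 <-> forall x, h (chain_d A m x) = 0.
  by split=> [/lin_eq_at//|h0]; exact: linear_ext.
apply: (homology_iso (a := hom_pre N (f n))) => [h|h|h] /cocycle hd.
- by apply/cocycle => x; rewrite hom_preE fd hd.
- case: n h hd => [|n] h hd; split=> -[k kh].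
  + by exists 0; rewrite linear0 -kh linear0.
  + exists 0; apply: linear_ext => y; rewrite linear0.
    have := lin_eq_at kh (g 0%N y).
    by rewrite hom_preE t0 linearD hd addr0 => <-.
  + exists (hom_pre N (f n) k); apply: linear_ext => x.
    by rewrite -kh [LHS]hom_preE [RHS]hom_preE hom_preE fd.
  + exists (hom_pre N (g n) k - hom_pre N (t n) h); apply: linear_ext => y.
    rewrite [LHS]hom_preE lin_addE lin_oppE !hom_preE gd.
    have := lin_eq_at kh (g n.+1 y); rewrite [LHS]hom_preE => ->.
    by rewrite hom_preE tS !linearD hd addr0 addrK.
have hgd y : hom_pre N (g n) h (chain_d Y n y) = 0 by rewrite hom_preE gd hd.
exists (hom_pre N (g n) h); case: n h hd hgd => [|n] h hd hgd.
  exists 0; split; first exact/cocycle.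
  by apply: linear_ext => x; rewrite linear0 addr0 2!hom_preE s0 linearD hd addr0.
exists (- hom_pre N (s n) h); split; first exact/cocycle.
apply: linear_ext => x; rewrite lin_addE 2!hom_preE [X in _ + X]hom_preE lin_oppE.
by rewrite hom_preE sS !linearD hd addr0 addrK.
Qed.

(** ** The comparison theorem *)

(** The state carried along is a pair of consecutive terms: the next term exists
    only because the previous two are related. *)
Lemma dependent_sequence (T : nat -> Type) (P : forall n, T n -> T n.+1 -> Prop) a :
  (exists b, P 0%N a b) -> (forall n b c, P n b c -> exists d, P n.+1 c d) ->
  exists t : forall n, T n, t 0%N = a /\ forall n, P n (t n) (t n.+1).
Proof.
move=> /cid[b ab] step.
pose st n := {p : T n * T n.+1 | P n p.1 p.2}.
pose next n (p : st n) : st n.+1 :=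
  let: exist d Pd := cid (step n _ _ (proj2_sig p)) in exist _ (_, d) Pd.
pose fix s n : st n := if n is m.+1 then next m (s m) else exist _ (a, b) ab.
have sE n : (proj1_sig (s n.+1)).1 = (proj1_sig (s n)).2.
  by rewrite /= /next; case: (cid _).
exists (fun n => (proj1_sig (s n)).1); split=> // n.
by rewrite sE; exact: (proj2_sig (s n)).
Qed.

(** Cycles of Hom(P, X) lift along the differential: exactness of Hom(P, X) in
    elementary terms, see [liftsP]. *)
Definition lifts P X : Prop := forall n (h : {linear P -> X n}),
  (forall x, chain_out X n (h x) = 0) ->
  exists k : {linear P -> X n.+1}, forall x, chain_d X n (k x) = h x.

Lemma liftsP P X : lifts P X <-> chain_exact (hom_chain P X).
Proof.
have outE n h : chain_out (hom_chain P X) n h = 0 <-> forall x, chain_out X n (h x) = 0.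
  case: n h => [|n] h; first by split=> // _ x.
  split=> [h0 x|h0]; first exact: lin_eq_at h0 x.
  by apply: linear_ext => x; exact: h0.
rewrite chain_exactP; split=> L n h.
  move=> /outE/L[k kh]; exists k; exact: linear_ext.
by move=> /outE/L[k <-]; exists k.
Qed.

Lemma comparison X Y (f0 : {linear X 0%N -> Y 0%N}) :
  (forall n, lifts (X n.+1) Y) -> exists f, f 0%N = f0 /\ @chain_map X Y f.
Proof.
move=> XY; apply: (@dependent_sequence (fun n => {linear X n -> Y n})
  (fun n a b => forall x, a (chain_d X n x) = chain_d Y n (b x))).
  have [//|k kE] := XY _ _ (lin_comp f0 (chain_d X 0)).
  by exists k => x; rewrite kE.
move=> n a b ab; have [|k kE] := XY _ _ (lin_comp b (chain_d X n.+1)).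
  by move=> x; rewrite lin_compE /= -ab chain_dd linear0.
by exists k => x; rewrite kE.
Qed.

Lemma null_homotopy X Y z : @chain_map X Y z -> z 0%N = 0 ->
  (forall n, lifts (X n.+1) Y) ->
  exists s : forall n, {linear X n -> Y n.+1}, s 0%N = 0 /\
    forall n x, z n.+1 x = chain_d Y n.+1 (s n.+1 x) + s n (chain_d X n x).
Proof.
move=> zd z0 XY; apply: (@dependent_sequence (fun n => {linear X n -> Y n.+1})
  (fun n a b => forall x, z n.+1 x = chain_d Y n.+1 (b x) + a (chain_d X n x))).
  have [|k kE] := XY _ _ (z 1%N); first by move=> x; rewrite /= -zd z0.
  by exists k => x; rewrite kE addr0.
move=> n a b ab; have [|k kE] := XY _ _ (z n.+2 - lin_comp b (chain_d X n.+1)).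
  move=> x; rewrite lin_addE lin_oppE lin_compE /= linearB -zd ab chain_dd.
  by rewrite linear0 addr0 subrr.
by exists k => x; rewrite kE lin_addE lin_oppE subrK.
Qed.

(** ** Duality between homology and cohomology *)

(** A map h : V -> I vanishing on the image of f restricts to ker g and
    descends to the homology.  The restriction is zero exactly when h factors
    through g, and every functional on the homology extends to V; both use
    injectivity of I.  The map k stands for Hom(f, I), up to its behaviour
    outside its kernel, because in degree 0 the outgoing map of a complex is a
    zero endomorphism. *)
Lemma homology_dual I U V W (T : lmodType R)
    (f : {linear U -> V}) (g : {linear V -> W}) (k : {linear {linear V -> I} -> T}) :
  injective_mod I -> (forall u, g (f u) = 0) ->
  (forall h, k h = 0 <-> forall u, h (f u) = 0) ->
  mod_iso (homology_at (hom_pre I g) k) {linear homology_at f g -> I}.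
Proof.
move=> I_inj gf kP; pose incl := kernel_incl g.
pose q : {linear kernel g -> homology_at f g} := quot_pi (boundary f (g := g)).
have q_surj z : exists x, q x = z by exact: quot_pi_surj.
have [|r rE] := lin_factor_inj (j := hom_pre I q)
    (f := lin_comp (hom_pre I incl) (kernel_incl k)) (hom_pre_inj q_surj).
  move=> h.
  have [|c cE] := lin_factor_surj (f := hom_pre I incl (kernel_incl k h)) q_surj; last first.
    by exists c; exact: linear_ext.
  move=> x /quot_pi_eq0/boundaryP[u ux].
  rewrite hom_preE -[incl x]ux; move: u {ux}; apply/kP; exact: kernel_inclK.
have {}rE h x : r h (q x) = kernel_incl k h (incl x).
  exact: (lin_eq_at (rE h) x).
apply: (quot_mod_iso (f := r)) => [h|p].
  rewrite boundaryP; split=> [[c ch]|rh].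
    apply: linear_ext => z; have [x <-] := q_surj z.
    by rewrite rE -ch hom_preE kernel_inclK linear0.
  have [|c cE] := injective_factor I_inj (f := g) (h := kernel_incl k h).
    by move=> x /kernel_incl_surj[y <-]; rewrite -rE rh.
  by exists c; exact: linear_ext.
have [e eE] := I_inj _ _ incl (lin_comp p q) (@kernel_incl_inj _ _ _ g).
have /kernel_incl_surj[h hE] : k e = 0.
  apply/kP => u; have [x xu] := kernel_incl_surj (gf u).
  rewrite -xu eE lin_compE; apply: linear_at0; apply/quot_pi_eq0/boundaryP.
  by exists u.
exists h; apply: linear_ext => z; have [x <-] := q_surj z.
by rewrite rE hE eE.
Qed.

Lemma cochain_in_d Z n x : cochain_d Z n (cochain_in Z n x) = 0.
Proof. by case: n x => [|n] x; [rewrite linear0 | exact: cochain_dd]. Qed.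

Lemma cohomology_dual Z I n : injective_mod I ->
  mod_iso (chain_homology (cochain_hom Z I) n) {linear cochain_cohomology Z n -> I}.
Proof.
move=> I_inj; apply: homology_dual => // [|h]; first exact: cochain_in_d.
case: n h => [|n] h; first by split=> // _ u; rewrite linear0.
by split=> [/lin_eq_at//|h0]; exact: linear_ext.
Qed.

End Complexes.

(** * Proper resolutions by multiples of C *)

Section ProperResolutions.
Variables (R : comPzRingType) (C : lmodType R).
Implicit Types (X : chain R) (M N P Y : lmodType R).

(** By adjunction a map P (x) C -> X n is a map P -> Hom(C, X n); cycles of
    Hom(C, X) are boundaries, and P is projective. *)
Lemma lifts_tensor P X : lifts C X -> projective P -> lifts (tensor P C) X.
Proof.
move=> CX P_proj n h h0.
pose Z := kernel (hom_post C (chain_out X n)).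
pose j : {linear Z -> {linear C -> X n}} := kernel_incl _.
have j_inj : injective j by exact: kernel_incl_inj.
have cycleP (c : {linear C -> X n}) : (forall x, chain_out X n (c x) = 0) ->
    exists z, j z = c.
  by move=> c0; apply: kernel_incl_surj; apply: linear_ext => x; exact: c0.
have [|D DE] := lin_factor_inj (f := hom_post C (chain_d X n)) j_inj.
  move=> c; apply: cycleP => x; rewrite hom_postE.
  exact: chain_out_d.
have [|H HE] := lin_factor_inj (f := lin_comp (hom_post C h) (tens_bilin P C)) j_inj.
  by move=> p; apply: cycleP => x; exact: h0.
have [|k kE] := P_proj _ _ D H.
  move=> z; have [|c cE] := CX n (j z).
    by move=> x; exact: (lin_eq_at (kernel_inclK z) x).
  by exists c; apply: j_inj; rewrite DE; exact: linear_ext.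
exists (tensor_lift k); apply: (tensor_eq (f := lin_comp (chain_d X n) (tensor_lift k))).
move=> p c; rewrite lin_compE tensor_liftE -[LHS]hom_postE.
by rewrite -DE kE HE.
Qed.

Lemma lifts_iso P Y X : mod_iso Y P -> lifts P X -> lifts Y X.
Proof.
move=> [f f_bij] PX n h h0; have [g [fK gK]] := lin_inv f_bij.
have [|k kE] := PX n (lin_comp h g); first by move=> x; exact: h0.
by exists (lin_comp k f) => x; rewrite lin_compE kE lin_compE fK.
Qed.

Lemma lifts_PC Y X : lifts C X -> in_PC C Y -> lifts Y X.
Proof.
by move=> CX [P P_proj /lifts_iso]; apply; exact: lifts_tensor.
Qed.

Lemma PC_resolution_lifts M (L : PC_resolution C M) Y :
  in_PC C Y -> lifts Y (plus_chain L).
Proof. by move=> Y_PC; apply/liftsP; exact: PC_res_proper. Qed.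

(** The comparison maps between the augmented complexes are taken over the
    identity of M, so their composites differ from the identity by a map that
    vanishes in degree 0 and is therefore null-homotopic. *)
Lemma PC_resolution_hequiv M (L L' : PC_resolution C M) : inhabited (hequiv L L').
Proof.
have lft (K K' : PC_resolution C M) n : lifts (plus_chain K n.+1) (plus_chain K').
  by apply: PC_resolution_lifts; exact: PC_res_in.
have [f [f0 fd]] := @comparison R (plus_chain L) (plus_chain L') (lin_id M) (lft L L').
have [g [g0 gd]] := @comparison R (plus_chain L') (plus_chain L) (lin_id M) (lft L' L).
have hty (K K' : PC_resolution C M)
    (a : forall n, {linear plus_chain K n -> plus_chain K' n})
    (b : forall n, {linear plus_chain K' n -> plus_chain K n}) :
    chain_map a -> chain_map b ->
    a 0%N = lin_id M -> b 0%N = lin_id M ->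
    {s | @homotopic_id R K (fun n x => b n.+1 (a n.+1 x)) s}.
  move=> ad bd a0 b0; apply: cid.
  have [|||s [s0 sS]] := @null_homotopy R (plus_chain K) (plus_chain K)
      (fun n => lin_comp (b n) (a n) - lin_id (plus_chain K n)).
  - by move=> n x; rewrite !lin_addE !lin_oppE !lin_compE ad bd [RHS]linearB.
  - by rewrite a0 b0; apply: linear_ext => x; exact: subrr.
  - exact: lft.
  exists (fun n => s n.+1); split=> [x|n x].
    have := sS 0%N x; rewrite s0 addr0 => <-.
    by rewrite lin_addE lin_oppE lin_compE addrC subrK.
  have := sS n.+1 x; rewrite -[X in _ = X -> _]/(_ + s n.+1 (chain_d K n x)).
  rewrite -addrA => <-.
  by rewrite lin_addE lin_oppE lin_compE addrC subrK.
have [s sP] := hty _ _ f g fd gd f0 g0.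
have [t tP] := hty _ _ g f gd fd g0 f0.
split; apply: (@HEquiv R L L' (fun n => f n.+1) (fun n => g n.+1) s t) => //.
  by move=> n x; exact: (fd n.+1).
by move=> n x; exact: (gd n.+1).
Qed.

Lemma projective_free n : projective (pw n R^o).
Proof.
move=> U V g h g_surj.
have /choice[s sE] : forall i, exists x, g x = h (pbase R i) by move=> i; exact: g_surj.
have gs : lin_comp g (pcomb s) = h.
  by apply: pw_ext => i; rewrite lin_compE pcomb_base sE.
by exists (pcomb s) => r; rewrite -gs.
Qed.

Lemma pw_iso n : mod_iso (pw n C) (tensor (pw n R^o) C).
Proof.
have co_lin : linear (fun z : tensor (pw n R^o) C => (fun i => tcoord C i z) : pw n C).
  by move=> a z w; apply/funext => i; rewrite linearP.
apply: mod_iso_sym; exists (mk_lin co_lin); apply: linear_bij => [z z0|c].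
  by apply: tcoord_inj => i; exact: (congr1 (fun r : pw n C => r i) z0).
exists (\sum_(i < n) tens (pbase R i) (c i)); apply/funext => i.
exact: tcoord_sum_base.
Qed.

Lemma power_in_PC n : in_PC C (pw n C).
Proof. by exists (pw n R^o); [exact: projective_free | exact: pw_iso]. Qed.

(** ** A proper resolution by powers of C *)

Hypothesis R_noeth : noetherian R.
Hypothesis C_fg : fin_gen C.

Record fgmod := FgMod { fgmod_obj :> lmodType R; fgmod_fg : fin_gen fgmod_obj }.

Implicit Type A : fgmod.

Definition hom_gens (A : fgmod) : {n & {s : pw n {linear C -> A} |
  forall h, exists r, pcomb s r = h}}.
Proof.
have /cid[n /cid sP] := fin_gen_pcomb (fin_gen_hom R_noeth C_fg (fgmod_fg A)).
by exists n.
Qed.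

Definition cover_rank A := projT1 (hom_gens A).
Definition cover_gens A : pw (cover_rank A) {linear C -> A} :=
  sval (projT2 (hom_gens A)).

Arguments cover_gens : clear implicits.

Lemma cover_linear A :
  linear (fun c : pw (cover_rank A) C => \sum_i cover_gens A i (c i)).
Proof.
move=> a c c'; rewrite scaler_sumr -big_split; apply: eq_bigr => i _.
by rewrite -[(_ + _) i]/(a *: c i + c' i) linearP.
Qed.

(** The map C^n -> A given by n generators of Hom(C, A); every map C -> A
    factors through it. *)
Definition cover A : {linear pw (cover_rank A) C -> A} := mk_lin (@cover_linear A).

Lemma cover_lift A (h : {linear C -> A}) :
  exists k : {linear C -> pw (cover_rank A) C}, forall c, cover A (k c) = h c.
Proof.
have [r rh] := proj2_sig (projT2 (hom_gens A)) h.
have k_lin : linear (fun c : C => (fun i => (r i : R) *: c) : pw (cover_rank A) C).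
  move=> a c c'; apply/funext => i.
  by rewrite -[RHS]/(a *: ((r i : R) *: c) + (r i : R) *: c') scalerDr !scalerA mulrC.
exists (mk_lin k_lin) => c; rewrite -rh pcombE lin_sumE mk_linE.
by apply: eq_bigr => i _; rewrite lin_scaleE linearZ.
Qed.

Definition syzygy A : fgmod :=
  FgMod (fin_gen_inj R_noeth (@kernel_incl_inj _ _ _ (cover A))
           (fin_gen_pw (cover_rank A) C_fg)).

Lemma syzygy_lift A (h : {linear C -> pw (cover_rank A) C}) :
  (forall c, cover A (h c) = 0) ->
  exists k : {linear C -> pw (cover_rank (syzygy A)) C},
    forall c, kernel_incl _ (cover (syzygy A) (k c)) = h c.
Proof.
move=> h0; have [|h' h'E] := lin_factor_inj (f := h) (@kernel_incl_inj _ _ _ (cover A)).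
  by move=> c; apply: kernel_incl_surj; exact: h0.
by have [k kE] := @cover_lift (syzygy A) h'; exists k => c; rewrite kE h'E.
Qed.

Variables (M : lmodType R) (M_fg : fin_gen M).

Definition syz n : fgmod := iter n syzygy (FgMod M_fg).

Definition power_obj n : lmodType R := pw (cover_rank (syz n)) C.

Definition power_d n : {linear power_obj n.+1 -> power_obj n} :=
  lin_comp (kernel_incl (cover (syz n))) (cover (syz n.+1)).

Lemma power_dd n x : power_d n (power_d n.+1 x) = 0.
Proof. by rewrite /power_d 2!lin_compE kernel_inclK linear0. Qed.

Lemma power_aug_d x : cover (syz 0) (power_d 0 x) = 0.
Proof. exact: kernel_inclK. Qed.

Definition power_augmented : augmented M :=
  @Augmented R M (Chain power_dd) (cover (syz 0)) power_aug_d.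

Lemma power_lifts : lifts C (plus_chain power_augmented).
Proof.
case=> [|n] h h0.
  by have [k kE] := @cover_lift (syz 0) h; exists k.
have {}h0 c : cover (syz n) (h c) = 0.
  case: n h h0 => [|n] h h0; first exact: h0.
  by apply: (@kernel_incl_inj _ _ _ (cover (syz n))); rewrite linear0; exact: h0.
by have [k kE] := syzygy_lift h0; exists k.
Qed.

Definition power_resolution : PC_resolution C M.
Proof.
apply: (@PCResolution R C M power_augmented) => [n|Y Y_PC]; first exact: power_in_PC.
by apply/liftsP/lifts_PC => //; exact: power_lifts.
Defined.

End ProperResolutions.

(** * Quasi-isomorphisms of complexes of flat modules *)

Section FlatComplexes.
Variable R : comPzRingType.
Implicit Types (X Y K G A : chain R) (U V M : lmodType R).

Definition exact_at X n : Prop :=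
  forall x, chain_out X n x = 0 -> exists y, chain_d X n y = x.

(** The complex X without its degree 0 part; shifting [plus_chain L] gives
    back the differentials of L. *)
Definition shift X : chain R := Chain (fun n => chain_dd (c := X) (n := n.+1)).

(** Exact augmented complexes resolve their modules in degree 0, so a map which
    is bijective there is a quasi-isomorphism of the resolutions. *)
Lemma quasi_iso_shift X Y f : chain_exact X -> chain_exact Y ->
  @chain_map R X Y f -> bijective (f 0%N) ->
  @quasi_iso R (shift X) (shift Y) (fun n => f n.+1).
Proof.
move=> /chain_exactP Xex /chain_exactP Yex fd f0_bij n; split=> [x x0 [y yx]|y y0].
  apply: (Xex n.+1); case: n => [|n] in x x0 y yx *; last exact: x0.
  apply: (bij_inj f0_bij); rewrite linear0 fd -yx; exact: chain_dd.
case: n => [|n] in y y0 *; last first.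
  by have [u uy] := Yex _ y y0; exists 0, u; rewrite !linear0 add0r.
have [x0 x0y] := bij_surj f0_bij (chain_d Y 0 y).
have [x xx0] := Xex 0%N x0 erefl.
have [|u uE] := Yex 1%N (y - f 1%N x).
  by rewrite /= linearB -fd xx0 x0y subrr.
by exists x, u; split=> //; rewrite -[X in _ + X]/(chain_d Y 1 u) uE addrC subrK.
Qed.

(** ** Mapping cones *)

(** The mapping cone of f, in degree n the direct sum of X (n - 1) and Y n,
    presented by its injections and projections: in this form it is visibly
    preserved by additive functors. *)
Record is_cone X Y (f : forall n, {linear X n -> Y n}) K
    (i1 : forall n, {linear X n -> K n.+1}) (i2 : forall n, {linear Y n -> K n})
    (p1 : forall n, {linear K n.+1 -> X n}) (p2 : forall n, {linear K n -> Y n}) :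
    Prop := IsCone {
  cone_di1 : forall x, chain_d K 0 (i1 0%N x) = i2 0%N (f 0%N x);
  cone_di1S : forall n x,
    chain_d K n.+1 (i1 n.+1 x) = i2 n.+1 (f n.+1 x) - i1 n (chain_d X n x);
  cone_di2 : forall n y, chain_d K n (i2 n.+1 y) = i2 n (chain_d Y n y);
  cone_p1i1 : forall n x, p1 n (i1 n x) = x;
  cone_p1i2 : forall n y, p1 n (i2 n.+1 y) = 0;
  cone_p2i1 : forall n x, p2 n.+1 (i1 n x) = 0;
  cone_p2i2 : forall n y, p2 n (i2 n y) = y;
  cone_sum0 : forall z, i2 0%N (p2 0%N z) = z;
  cone_sumS : forall n z, i1 n (p1 n z) + i2 n.+1 (p2 n.+1 z) = z
}.

Section Cone.
Variables (X Y K : chain R) (f : forall n, {linear X n -> Y n}).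
Variables (i1 : forall n, {linear X n -> K n.+1}) (i2 : forall n, {linear Y n -> K n}).
Variables (p1 : forall n, {linear K n.+1 -> X n}) (p2 : forall n, {linear K n -> Y n}).
Hypothesis fK : is_cone f i1 i2 p1 p2.
Hypothesis fd : chain_map f.

Lemma cone_di1_cycle n x : chain_out X n x = 0 -> chain_d K n (i1 n x) = i2 n (f n x).
Proof.
case: fK => di1 di1S _ _ _ _ _ _ _; case: n x => [|n] x //= x0.
by rewrite di1S x0 linear0 subr0.
Qed.

Lemma cone_p1_d n z : p1 n (chain_d K n.+1 z) = - chain_d X n (p1 n.+1 z).
Proof.
case: fK => _ di1S di2 p1i1 p1i2 _ _ _ sumS.
by rewrite -{1}(sumS _ z) linearD di1S di2 !linearD linearN !p1i2 p1i1 add0r addr0.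
Qed.

Lemma cone_p2_d n z :
  p2 n (chain_d K n z) = f n (p1 n z) + chain_d Y n (p2 n.+1 z).
Proof.
case: fK => di1 di1S di2 _ _ p2i1 p2i2 _ sumS.
rewrite -{1}(sumS _ z) linearD linearD di2 p2i2; congr (_ + _).
case: n z => [|n] z; first by rewrite di1 p2i2.
by rewrite di1S linearB p2i2 p2i1 subr0.
Qed.

Lemma cone_eq n z w : p1 n z = p1 n w -> p2 n.+1 z = p2 n.+1 w -> z = w.
Proof. by case: fK => _ _ _ _ _ _ _ _ sumS e1 e2; rewrite -(sumS n z) e1 e2 sumS. Qed.

(** For x a cycle and f x = d y, the element (x, - y) of the cone is a cycle,
    and a bounding element exhibits x as a boundary; for y a cycle, a bounding
    element of (0, y) exhibits y as homologous to f x for a cycle x. *)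
Lemma cone_quasi_iso : chain_exact K -> quasi_iso f.
Proof.
move=> /chain_exactP Kex n; case: (fK) => _ _ di2 p1i1 p1i2 p2i1 p2i2 _ _.
split=> [x x0 [y yx]|y y0].
  have [|z zE] := Kex n.+1 (i1 n x - i2 n.+1 y).
    by rewrite linearB cone_di1_cycle // di2 yx subrr.
  exists (- p1 n.+1 z); rewrite linearN -cone_p1_d zE linearB p1i1 p1i2.
  exact: subr0.
have [|z zE] := Kex n (i2 n y).
  by case: n y y0 => [|n] y //= y0; rewrite di2 y0 linear0.
exists (p1 n z), (p2 n.+1 z); rewrite -cone_p2_d zE p2i2; split=> //.
case: n y y0 z zE => [|n] y y0 z zE //=.
by apply: oppr_inj; rewrite -cone_p1_d zE p1i2 oppr0.
Qed.

Lemma cone_exact : quasi_iso f -> chain_exact K.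
Proof.
move=> f_qi; case: (fK) => _ _ di2 p1i1 p1i2 p2i1 p2i2 sum0 sumS.
apply/chain_exactP => -[|n] z z0.
  have [_ /(_ (p2 0%N z) erefl)[x [u [_ xu]]]] := f_qi 0%N.
  exists (i1 0%N x + i2 1%N u); rewrite -[RHS]sum0 -xu linearD di2.
  by rewrite cone_di1_cycle // linearD.
have q0 : chain_out X n (p1 n z) = 0.
  case: n z z0 => [|n] z z0 //=.
  by apply: oppr_inj; rewrite -cone_p1_d [X in p1 _ X]z0 linear0 oppr0.
have qf : f n (p1 n z) + chain_d Y n (p2 n.+1 z) = 0.
  by rewrite -cone_p2_d [X in p2 _ X]z0 linear0.
have [f_inj _] := f_qi n; have [_ f_surj] := f_qi n.+1.
have [|q' qq'] := f_inj _ q0.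
  by exists (- p2 n.+1 z); rewrite linearN; apply/eqP; rewrite eq_sym -addr_eq0 qf.
have [|x [u [x0 xu]]] := f_surj (p2 n.+1 z + f n.+1 q').
  by rewrite /= linearD -fd qq' addrC.
exists (i1 n.+1 (x - q') + i2 n.+2 u); apply: cone_eq.
  rewrite cone_p1_d (linearD (p1 n.+1)) p1i1 p1i2 addr0 linearB [X in X - _]x0.
  by rewrite sub0r opprK.
rewrite cone_p2_d (linearD (p1 n.+1)) (linearD (p2 n.+2)) p1i1 p1i2 p2i1 p2i2.
by rewrite addr0 add0r linearB addrAC xu addrK.
Qed.

End Cone.

Section ConeChain.
Variables (X Y : chain R) (f : forall n, {linear X n -> Y n}).
Hypothesis fd : chain_map f.

Definition cone_obj n : lmodType R :=
  if n is m.+1 then (X m * Y m.+1)%type else Y 0%N.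

Definition cone_i1 n : {linear X n -> cone_obj n.+1} := @pair_inl R (X n) (Y n.+1).
Definition cone_i2 n : {linear Y n -> cone_obj n} :=
  if n is m.+1 then @pair_inr R (X m) (Y m.+1) else lin_id (Y 0%N).
Definition cone_p1 n : {linear cone_obj n.+1 -> X n} := @pair_fst R (X n) (Y n.+1).
Definition cone_p2 n : {linear cone_obj n -> Y n} :=
  if n is m.+1 then @pair_snd R (X m) (Y m.+1) else lin_id (Y 0%N).

Definition cone_d n : {linear cone_obj n.+1 -> cone_obj n} :=
  let e : {linear cone_obj n.+1 -> Y n} :=
    lin_comp (f n) (cone_p1 n) + lin_comp (chain_d Y n) (cone_p2 n.+1) in
  match n return {linear cone_obj n.+1 -> Y n} -> {linear cone_obj n.+1 -> cone_obj n} with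
  | 0 => id
  | m.+1 => fun e => lin_comp (cone_i2 m.+1) e
                     - lin_comp (cone_i1 m) (lin_comp (chain_d X m) (cone_p1 m.+1))
  end e.

Lemma cone_dE n q y : cone_d n.+1 (q, y) = (- chain_d X n q, f n.+1 q + chain_d Y n.+1 y).
Proof. by rewrite -[LHS]/(0 - _, _ - 0) sub0r subr0. Qed.

Lemma cone_d0E q y : cone_d 0 (q, y) = f 0%N q + chain_d Y 0 y.
Proof. by []. Qed.

Lemma cone_dd n z : cone_d n (cone_d n.+1 z) = 0.
Proof.
case: z => q y; rewrite cone_dE; case: n q y => [|n] q y.
  by rewrite cone_d0E linearN linearD chain_dd addr0 fd addNr.
rewrite cone_dE (linearN (chain_d X n)) (linearN (f n.+1)) linearD !chain_dd.
by rewrite opprK addr0 fd addNr.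
Qed.

Definition cone : chain R := Chain cone_dd.

Lemma cone_is_cone : @is_cone X Y f cone cone_i1 cone_i2 cone_p1 cone_p2.
Proof.
split=> //=.
- by move=> x; rewrite -[LHS]/(cone_d 0 (x, 0)) cone_d0E linear0 addr0.
- move=> n x; rewrite -[LHS]/(cone_d n.+1 (x, 0)) cone_dE linear0 addr0.
  by rewrite -[RHS]/(0 - _, _ - 0) sub0r subr0.
- case=> [|n] y.
    by rewrite -[LHS]/(cone_d 0 (0, y)) cone_d0E linear0 add0r.
  by rewrite -[LHS]/(cone_d n.+1 (0, y)) cone_dE !linear0 add0r.
- by case.
- by move=> n [q y]; rewrite -[LHS]/(q + 0, 0 + y) addr0 add0r.
Qed.

Lemma flat_cone : (forall n, flat (X n)) -> (forall n, flat (Y n)) ->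
  forall n, flat (cone n).
Proof. by move=> Xf Yf [|n]; [exact: Yf | exact: flat_pair]. Qed.

End ConeChain.

Lemma tensor_is_cone M X Y (f : forall n, {linear X n -> Y n}) K i1 i2 p1 p2 :
  @is_cone X Y f K i1 i2 p1 p2 ->
  @is_cone (tensor_chain M X) (tensor_chain M Y) (fun n => tmapr M (f n))
    (tensor_chain M K) (fun n => tmapr M (i1 n)) (fun n => tmapr M (i2 n))
    (fun n => tmapr M (p1 n)) (fun n => tmapr M (p2 n)).
Proof.
have comp0 (U V W : lmodType R) (g : {linear V -> W}) (h : {linear U -> V})
      (e : {linear U -> W}) :
    (forall u, g (h u) = e u) -> forall z, tmapr M g (tmapr M h z) = tmapr M e z.
  move=> gh z; rewrite -[LHS]tmapr_comp; congr (GRing.Linear.sort (tmapr M _) z).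
  exact: linear_ext.
have tmapr0 (U V : lmodType R) z : tmapr M (0 : {linear U -> V}) z = 0.
  by apply: (tensor_eq (g := 0)) => u v; rewrite tmaprE lin_zeroE tens0r.
case=> di1 di1S di2 p1i1 p1i2 p2i1 p2i2 sum0 sumS; split.
- move=> z; apply: etrans (tmapr_comp _ _ _).
  by apply: comp0 => x; rewrite di1.
- move=> n z; apply: etrans (comp0 _ _ _ _ _
    (lin_comp (i2 n.+1) (f n.+1) - lin_comp (i1 n) (chain_d X n)) _ z) _ => //.
  apply: etrans (tmaprD _ _ _) _; apply: etrans (congr1 (+%R _) (tmaprN _ _)) _.
  by congr (_ - _); exact: tmapr_comp.
- move=> n z; apply: etrans (tmapr_comp _ _ _).
  by apply: comp0 => x; rewrite di2.
- by move=> n z; rewrite -[RHS]tmapr_id; exact: comp0.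
- by move=> n z; rewrite -[RHS](tmapr0 (Y n.+1) (X n) z); exact: comp0.
- by move=> n z; rewrite -[RHS](tmapr0 (X n) (Y n.+1) z); exact: comp0.
- by move=> n z; rewrite -[RHS]tmapr_id; exact: comp0.
- by move=> z; rewrite -[RHS]tmapr_id; exact: comp0.
move=> n z; apply: etrans (esym _) (tmapr_id z).
have -> : lin_id (K n.+1) = lin_comp (i1 n) (p1 n) + lin_comp (i2 n.+1) (p2 n.+1).
  by apply: linear_ext => x; rewrite lin_addE !lin_compE sumS.
apply: etrans (tmaprD _ _ _) _.
by congr (_ + _); exact: tmapr_comp.
Qed.

(** ** Tensoring exact complexes of flat modules *)

Section ShortExact.
Variables (K G A : chain R).
Variables (i : forall n, {linear K n -> G n}) (p : forall n, {linear G n -> A n}).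
Hypotheses (i_map : chain_map i) (pd : chain_map p).
Hypothesis i_inj : forall n, injective (i n).
Hypothesis p_surj : forall n y, exists x, p n x = y.
Hypothesis pi0 : forall n x, p n (i n x) = 0.
Hypothesis ker_p : forall n y, p n y = 0 -> exists x, i n x = y.
Hypothesis G_exact : forall n, exact_at G n.

Lemma exact_at_quotient0 : exact_at A 0.
Proof.
move=> z _; have [y <-] := p_surj z; have [x <-] := @G_exact 0%N y erefl.
by exists (p 1%N x); rewrite pd.
Qed.

(** The connecting map of 0 -> K -> G -> A -> 0 embeds the homology of A in
    degree n + 1 in that of K in degree n, as G is exact. *)
Lemma exact_at_quotientS n : exact_at K n -> exact_at A n.+1.
Proof.
move=> K_exact z z0; have [y yz] := p_surj z.
have [|w wy] := @ker_p n (chain_d G n y); first by rewrite pd yz.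
have [|v vw] := K_exact w.
  case: n K_exact z z0 y yz w wy => [|n] _ z z0 y yz w wy //=.
  by apply: i_inj; rewrite i_map wy chain_dd linear0.
have [|u uE] := @G_exact n.+1 (y - i n.+1 v).
  by rewrite /= linearB -i_map vw wy subrr.
by exists (p n.+2 u); rewrite -pd uE linearB pi0 subr0.
Qed.

End ShortExact.

Lemma tensor_chain_map M X Y (f : forall n, {linear X n -> Y n}) :
  chain_map f ->
  @chain_map R (tensor_chain M X) (tensor_chain M Y) (fun n => tmapr M (f n)).
Proof.
move=> fd n z.
apply: (tensor_eq (f := lin_comp (tmapr M (f n)) (tmapr M (chain_d X n)))
                  (g := lin_comp (tmapr M (chain_d Y n)) (tmapr M (f n.+1)))) => u v.
by rewrite !lin_compE !tmaprE fd.
Qed.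

Lemma tensor_chain_mapl M M' X (p : {linear M -> M'}) :
  @chain_map R (tensor_chain M X) (tensor_chain M' X) (fun n => tmapl (X n) p).
Proof. by move=> n z; exact: tmap_swap. Qed.

Lemma exact_tensor_free X m : chain_exact X ->
  forall n, exact_at (tensor_chain (pw m R^o) X) n.
Proof.
move=> /chain_exactP Xex n z z0.
have /choice[y yE] : forall i, exists y, chain_d X n y = tcoord (X n) i z.
  move=> i; apply: Xex; case: n z z0 => [|n] z z0 //.
  by rewrite -[LHS]tcoord_tmapr; apply: linear_at0.
exists (\sum_(i < m) tens (pbase R i) (y i)).
rewrite [RHS]tcoord_sum linear_sum; apply: eq_bigr => i _.
by apply: etrans (tmaprE _ _ _) _; rewrite yE.
Qed.

Hypothesis R_noeth : noetherian R.

(** Dimension shifting on M: for 0 -> K -> R^m -> M -> 0, flatness makes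
    0 -> K (x) X -> R^m (x) X -> M (x) X -> 0 exact, and K is again finitely
    generated. *)
Lemma exact_tensor_flat X : chain_exact X -> (forall n, flat (X n)) ->
  forall M, fin_gen M -> chain_exact (tensor_chain M X).
Proof.
move=> Xex Xflat M M_fg; apply/chain_exactP => n.
rewrite -/(exact_at _ n); elim: n M M_fg => [|n IHn] M M_fg;
  have [m [s s_surj]] := fin_gen_pcomb M_fg.
  apply: (exact_at_quotient0 (@tensor_chain_mapl _ _ X (pcomb s))).
    by move=> n; exact: tmapl_surj.
  exact: exact_tensor_free.
pose K := kernel (pcomb s); pose j : {linear K -> _} := kernel_incl (pcomb s).
have K_fg : fin_gen K.
  apply: (fin_gen_inj R_noeth (@kernel_incl_inj _ _ _ (pcomb s))).
  exact: fin_gen_pw (fin_gen_reg R).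
apply: (exact_at_quotientS (@tensor_chain_mapl _ _ X j)
  (@tensor_chain_mapl _ _ X (pcomb s))).
- by move=> n'; apply: Xflat => //; exact: kernel_incl_inj.
- by move=> n'; exact: tmapl_surj.
- move=> n' x; apply: (tensor_eq (g := 0)
    (f := lin_comp (tmapl (X n') (pcomb s)) (tmapl (X n') j))) => u v.
  by rewrite lin_compE !tmaplE kernel_inclK tens0l.
- move=> n' y; apply: tmapl_exact => // x; exact: kernel_incl_surj.
- exact: exact_tensor_free.
exact: IHn.
Qed.

Lemma quasi_iso_tensor_flat X Y (f : forall n, {linear X n -> Y n}) M :
  chain_map f -> quasi_iso f ->
  (forall n, flat (X n)) -> (forall n, flat (Y n)) -> fin_gen M ->
  @quasi_iso R (tensor_chain M X) (tensor_chain M Y) (fun n => tmapr M (f n)).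
Proof.
move=> fd f_qi Xflat Yflat M_fg; have fK := cone_is_cone fd.
apply: (cone_quasi_iso (tensor_is_cone M fK)).
apply: (exact_tensor_flat _ _ M_fg); last exact: flat_cone.
exact: (cone_exact fK fd f_qi).
Qed.

End FlatComplexes.

(** * Hom-tensor duality for relative Tor and Ext *)

Section RelativeDuality.
Variables (R : comPzRingType) (C : lmodType R).
Hypothesis R_noeth : noetherian R.
Hypothesis C_sd : semidualizing C.
Implicit Types (M N I : lmodType R).

Lemma Tor_PCM_dual M N I (L1 L2 : PC_resolution C M) i :
  fin_gen M -> injective_mod I ->
  mod_iso (Tor_PCM L1 {linear N -> I} i) {linear Ext_PCM L2 N i -> I}.
Proof.
move=> M_fg I_inj; have [C_fg _ _] := C_sd.
pose P := power_resolution R_noeth C_fg M_fg.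
have [L1P] := PC_resolution_hequiv L1 P; have [L2P] := PC_resolution_hequiv L2 P.
apply: mod_iso_trans (hequiv_homology i (hequiv_tensor _ L1P)) _.
apply: mod_iso_trans (mod_iso_hom I (mod_iso_sym (hequiv_hom N i L2P))).
apply: mod_iso_trans (cohomology_dual (chain_hom P N) i I_inj).
apply: (@iso_homology R (chain_tensor P {linear N -> I})
  (cochain_hom (chain_hom P N) I) (fun n => teval (P n) N I)) => n => [z|].
  apply: linear_ext => h; apply: etrans (teval_natl _ _ _) _.
  by congr (teval _ _ _ _ _); exact: linear_ext.
by apply: (teval_bij R_noeth) => //; exact: fin_gen_pw.
Qed.

Section Coresolution.
Variables (N I : lmodType R) (J : IC_coresolution C N).
Hypothesis I_inj : injective_mod I.

(** The complex W = Hom(J, I), augmented to Hom(N, I), of modules T (x) C with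
    T flat. *)
Definition dual_res : chain R := cochain_hom J I.
Definition dual_res_plus : chain R := cochain_hom (coplus_cochain J) I.

Definition lin_swap (U V W : lmodType R) (h : {linear U -> {linear V -> W}}) :
  {linear V -> {linear U -> W}}.
Proof.
apply: (@mk_bilin R V U W (fun v u => h u v)) => [v|u].
  by move=> a x y; rewrite linearP.
by move=> a x y; rewrite linearP.
Defined.

(** Hom(C, Hom(J, I)) is Hom(J, Hom(C, I)), and Hom(C, I) lies in I_C, so this
    is properness of J. *)
Lemma dual_res_lifts : lifts C dual_res_plus.
Proof.
have CI : in_IC C {linear C -> I} by exists I => //; exists (lin_id _); exists id.
move=> n h h0; have /chain_exactP Jex := @IC_res_proper _ _ _ J _ CI.
have [|k kE] := Jex n (lin_swap h).
  case: n h h0 => [|n] h h0 //; apply: linear_ext => x; apply: linear_ext => c.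
  exact: (lin_eq_at (h0 c) x).
exists (lin_swap k) => c; apply: linear_ext => x.
exact: (lin_eq_at (lin_eq_at kE x) c).
Qed.

Lemma in_PC_self : in_PC C C.
Proof.
have [P P_proj CP] := power_in_PC C 1; exists P => //; apply: mod_iso_trans CP.
have d_lin : linear (fun c : C => (fun _ => c) : pw 1 C) by [].
exists (mk_lin d_lin); exists (fun r => r ord0) => // r.
by apply/funext => i; rewrite [i]ord1.
Qed.

Lemma fin_gen_tensor M : fin_gen M -> fin_gen (tensor M C).
Proof.
have [C_fg _ _] := C_sd; move=> /fin_gen_pcomb[n [s s_surj]].
apply: (fin_gen_surj (tmapl_surj (V := C) s_surj)).
exact: fin_gen_iso (pw_iso C n) (fin_gen_pw n C_fg).
Qed.

(** The comparison map from L to W over the identity of Hom(N, I) becomes,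
    after Hom(C, -), a quasi-isomorphism between complexes of flat modules; it
    remains one after tensoring with M (x) C, which gives back M (x) L and
    M (x) W up to isomorphism. *)
Lemma Tor_MPC_dual M (L : PC_resolution C {linear N -> I}) i : fin_gen M ->
  mod_iso (Tor_MPC M L i) {linear Ext_MIC M J i -> I}.
Proof.
move=> M_fg.
have L_flat n := in_PC_flat_multiple (PC_res_in L n).
have J_flat n : flat_multiple C (dual_res n).
  exact: (dual_IC_flat_multiple R_noeth C_sd (IC_res_in J n) I_inj).
apply: (@mod_iso_trans _ (chain_homology (tensor_chain M dual_res) i)); last first.
  apply: mod_iso_trans (cohomology_dual (hom_cochain M J) i I_inj).
  apply: (@iso_homology R (tensor_chain M dual_res)
    (cochain_hom (hom_cochain M J) I) (fun n => teval M (J n) I)) => n => [z|].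
    apply: linear_ext => h; exact: teval_natr.
  exact: (teval_bij R_noeth).
have contract (X : chain R) : (forall n, flat_multiple C (X n)) ->
    mod_iso (chain_homology (tensor_chain (tensor M C) (hom_chain C X)) i)
            (chain_homology (tensor_chain M X) i).
  move=> X_flat; apply: (@iso_homology R (tensor_chain (tensor M C) (hom_chain C X))
    (tensor_chain M X) (fun n => tcontract M C (X n))) => n => [z|].
    exact: tcontract_nat.
  exact: (tcontract_bij R_noeth C_sd).
apply: mod_iso_trans (mod_iso_sym (contract _ L_flat)) _.
apply: mod_iso_trans (contract _ J_flat).
have [|f [f0 fd]] := @comparison R (plus_chain L) dual_res_plus (lin_id _).
  by move=> n; apply: lifts_PC (PC_res_in L n); exact: dual_res_lifts.
have hfd : @chain_map R (hom_chain C (plus_chain L)) (hom_chain C dual_res_plus)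
    (fun n => hom_post C (f n)).
  by move=> n h; apply: linear_ext => c; exact: fd.
have L_exact : chain_exact (hom_chain C (plus_chain L)).
  by apply/liftsP/PC_resolution_lifts/in_PC_self.
have J_exact : chain_exact (hom_chain C dual_res_plus).
  by apply/liftsP; exact: dual_res_lifts.
have f_qi := quasi_iso_shift L_exact J_exact hfd.
have {}f_qi : @quasi_iso R (hom_chain C L) (hom_chain C dual_res)
    (fun n => hom_post C (f n.+1)).
  apply: f_qi; rewrite f0; exists id => h; exact: linear_ext.
have fLd : @chain_map R (hom_chain C L) (hom_chain C dual_res)
    (fun n => hom_post C (f n.+1)) by move=> n; exact: (hfd n.+1).
apply: (quasi_iso_homology (tensor_chain_map fLd)) (i).
apply: (quasi_iso_tensor_flat R_noeth fLd f_qi) => [n|n|].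
- exact: (flat_hom_multiple R_noeth C_sd).
- exact: (flat_hom_multiple R_noeth C_sd).
exact: fin_gen_tensor.
Qed.

End Coresolution.
End RelativeDuality.

Theorem proposition3p16 (R : comPzRingType) (R_noeth : noetherian R)
    (C : lmodType R) (C_semidualizing : semidualizing C)
    (M : lmodType R) (M_fg : fin_gen M) (N : lmodType R)
    (I : lmodType R) (I_inj : injective_mod I) :
  (forall (L1 L2 : PC_resolution C M) (i : nat),
     mod_iso (Tor_PCM L1 {linear N -> I} i) {linear Ext_PCM L2 N i -> I}) /\
  (forall (L : PC_resolution C {linear N -> I}) (J : IC_coresolution C N)
     (i : nat),
     mod_iso (Tor_MPC M L i) {linear Ext_MIC M J i -> I}).
Proof.
by split=> *; [exact: Tor_PCM_dual | exact: Tor_MPC_dual].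
Qed.
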